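(* For any integer $N\geq 2$ and any real $\beta\geq 1$, let $(x_1,\ldots,x_N)$ be a random configuration on $\mathbb{S}$ with joint distribution $\mathbb{P}_{N,\beta}$. For any constant $c>0$ we have $$\mathscr{H}_N(x_1,\ldots,x_N)-\min_{\mathbb{S}^N}\mathscr{H}_N\leq c\log N$$ with probability at least $1-\mathrm{e}^{-\kappa N}$, where $$\kappa:=c\,\frac{\beta}{N}\log N-\log\beta-8\log N.$$ Moreover, the mean energy satisfies $$\mathbb{E}_{\beta}\big[\mathscr{H}_N(x_1,\ldots,x_N)\big]-\min_{\mathbb{S}^N}\mathscr{H}_N\leq\frac{N}{\beta}\Big(\log\beta+8\log N\Big).$$
   Context: Let $\|\cdot\|$ be the Euclidean norm on $\mathbb{R}^3$ and $\mathbb{S}:=\{x\in\mathbb{R}^3:\|x\|=1\}$ the unit sphere. For $N\geq 2$, the logarithmic energy of a configuration $x=(x_1,\ldots,x_N)\in\mathbb{S}^N$ is $$\mathscr{H}_N(x)=\mathscr{H}_N(x_1,\ldots,x_N):=\sum_{i\neq j}\log\frac{1}{\|x_i-x_j\|},$$ where the sum is over all ordered pairs $(i,j)$ with $1\leq i,j\leq N$ and $i\neq j$, with value $+\infty$ if two of the points coincide. Let $\sigma$ be the uniform measure on $\mathbb{S}$ normalized so that $\sigma(\mathbb{S})=1$, i.e. $\sigma=(4\pi)^{-1}\mathrm{Vol}$ (surface measure divided by $4\pi$). For $N\geq 2$ and $\beta>0$, the Coulomb gas at inverse temperature $\beta$ is the probability measure on $\mathbb{S}^N$ $$\mathbb{P}_{N,\beta}(\mathrm{d}x):=\frac{1}{Z_{N,\beta}}\,\mathrm{e}^{-\beta\mathscr{H}_N(x)}\,\sigma^{\otimes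 N}(\mathrm{d}x),\qquad Z_{N,\beta}:=\int_{\mathbb{S}^N}\mathrm{e}^{-\beta\mathscr{H}_N(x)}\,\sigma^{\otimes N}(\mathrm{d}x),$$ with the convention $\mathrm{e}^{-\infty}=0$. $\mathbb{E}_\beta$ denotes expectation with respect to $\mathbb{P}_{N,\beta}$. *)

(* Defs.v *)
From HB Require Import structures.
From mathcomp Require Import all_boot all_order all_algebra.
From mathcomp Require Import all_classical all_reals all_analysis.
From mathcomp Require Import measurable_realfun.

Set Implicit Arguments.
Unset Strict Implicit.
Unset Printing Implicit Defensive.

Import Order.TTheory GRing.Theory Num.Theory.
Import numFieldNormedType.Exports.

Local Open Scope classical_set_scope.
Local Open Scope ring_scope.

Section euclidean_space.
Context {R : realType}.
Implicit Types x y : R * R * R.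

(* The library norm on [R * R * R] is the sup norm, hence this definition. *)
Definition enorm x : R :=
  Num.sqrt (x.1.1 ^+ 2 + x.1.2 ^+ 2 + x.2 ^+ 2).

Definition spherical_coord (p : R * R) : R * R * R :=
  (sin p.1 * cos p.2, sin p.1 * sin p.2, cos p.1).

Lemma enorm_spherical_coord p : enorm (spherical_coord p) == 1.
Proof.
rewrite /enorm /spherical_coord /= !exprMn -mulrDr cos2Dsin2 mulr1.
by rewrite addrC cos2Dsin2 sqrtr1.
Qed.

Lemma measurable_sin : measurable_fun setT (@sin R).
Proof. by apply: continuous_measurable_fun; exact: continuous_sin. Qed.

Lemma measurable_cos : measurable_fun setT (@cos R).
Proof. by apply: continuous_measurable_fun; exact: continuous_cos. Qed.

Lemma measurable_spherical_coord : measurable_fun setT spherical_coord.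
Proof.
have ms := measurable_sin; have mc := measurable_cos.
apply: measurable_fun_pair => /=; last exact: measurableT_comp.
apply: measurable_fun_pair => /=;
  by apply: measurable_funM; exact: measurableT_comp.
Qed.

Lemma measurable_enormB d (T : measurableType d) (f g : T -> R * R * R) :
  measurable_fun setT f -> measurable_fun setT g ->
  measurable_fun setT (fun t => enorm (f t - g t)).
Proof.
move=> mf mg.
have ms : measurable_fun setT (@Num.sqrt R).
  by apply: continuous_measurable_fun; exact: sqrt_continuous.
apply: (measurableT_comp ms) => /=.
by apply: measurable_funD; [apply: measurable_funD|];
  apply: measurable_funX; apply: measurable_funB;
  repeat (exact: mf || exact: mg ||
    apply: (measurableT_comp measurable_fst) ||
    apply: (measurableT_comp measurable_snd)).
Qed.

End euclidean_space.

Definition sphere (R : realType) : Type := {x : R * R * R | enorm x == 1}.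

Definition sphere_val (R : realType) (x : sphere R) : R * R * R := val x.

Definition sphere_param (R : realType) (p : R * R) : sphere R :=
  exist _ (spherical_coord p) (enorm_spherical_coord p).

HB.instance Definition _ (R : realType) := Choice.on (sphere R).
HB.instance Definition _ (R : realType) :=
  isPointed.Build (sphere R) (sphere_param (0, 0)).

(* Borel sets of the sphere, as traces of the Borel sets of [R * R * R]. *)
HB.instance Definition _ (R : realType) := Measurable.copy (sphere R)
  (g_sigma_algebra_preimageType (@sphere_val R)).

Section uniform_measure.
Context {R : realType}.
Local Open Scope ereal_scope.

Local Notation leb := (@lebesgue_measure R).
Local Notation D := (`[0%R, pi] `*` `[0%R, (2 * pi)%R] : set (R * R)).

Lemma measurable_sphere_val : measurable_fun setT (@sphere_val R).
Proof. by move=> _ B mB; exists B. Qed.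

Lemma measurable_sphere_param : measurable_fun setT (@sphere_param R).
Proof.
move=> _ _ [B mB <-]; rewrite !setTI.
rewrite -[X in measurable X]setTI.
exact: measurable_spherical_coord.
Qed.

(* The surface measure, computed in the chart (theta, phi) |->
   [spherical_coord (theta, phi)], whose area element is sin theta. *)
Definition sphere_area (A : set (sphere R)) : \bar R :=
  \int[leb \x leb]_(p in D `&` @sphere_param R @^-1` A) (sin p.1)%:E.

Definition sphere_unif (A : set (sphere R)) : \bar R :=
  ((4 * pi)^-1)%:E * sphere_area A.

Lemma measurable_chart : measurable D.
Proof. by apply: measurableX; exact: measurable_itv. Qed.

Lemma sin_chart_ge0 p : D p -> 0 <= (sin p.1)%:E.
Proof.
case=> + _; rewrite /= in_itv /= => p1; rewrite lee_fin.
exact: sin_ge0_pi.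
Qed.

Lemma measurable_sin_chart (A : set (R * R)) :
  measurable_fun A (fun p : R * R => (sin p.1)%:E).
Proof.
apply/measurable_funTS/measurable_EFinP.
by apply: measurableT_comp => //; exact: measurable_sin.
Qed.

Lemma sphere_area0 : sphere_area set0 = 0.
Proof. by rewrite /sphere_area preimage_set0 setI0 integral_set0. Qed.

Lemma sphere_area_ge0 A : 0 <= sphere_area A.
Proof. by apply: integral_ge0 => p [/sin_chart_ge0]. Qed.

Lemma sphere_area_sigma_additive : semi_sigma_additive sphere_area.
Proof.
move=> F mF tF mUF; rewrite /sphere_area.
apply: cvg_toP.
  apply: ereal_nondecreasing_is_cvgn => m n mn.
  by apply: lee_sum_nneg_natr => // k _ _; exact: sphere_area_ge0.
rewrite preimage_bigcup setI_bigcupr ge0_integral_bigcup//=.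
- move=> k; apply: measurableI; first exact: measurable_chart.
  by rewrite -[X in measurable X]setTI; exact: measurable_sphere_param.
- exact: measurable_sin_chart.
- by move=> p [k _ [/sin_chart_ge0]].
- apply/trivIsetP => i j _ _ ij; rewrite setIACA -preimage_setI.
  by move/trivIsetP : tF => /(_ _ _ _ _ ij) ->//; rewrite preimage_set0 setI0.
Qed.

HB.instance Definition _ := isMeasure.Build _ _ _ sphere_area
  sphere_area0 sphere_area_ge0 sphere_area_sigma_additive.

Lemma integral_sin_0pi : \int[leb]_(t in `[0%R, pi]) (sin t)%:E = 2%:E.
Proof.
rewrite (@continuous_FTC2 _ _ (fun t => - cos t)%R) ?pi_gt0//.
- by rewrite cospi cos0 -EFinB opprK.
- by apply: continuous_subspaceT => x; exact: continuous_sin.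
- split.
  + by move=> x _; apply: derivableN.
  + by apply: cvgN; apply: cvg_at_right_filter; exact: continuous_cos.
  + by apply: cvgN; apply: cvg_at_left_filter; exact: continuous_cos.
- by move=> x _; rewrite derive1E deriveN// derive_val opprK.
Qed.

Lemma sphere_areaT : sphere_area setT = (4 * pi)%:E.
Proof.
rewrite /sphere_area preimage_setT setIT integral_mkcond.
set f := (X in \int[_]_p X p).
have f0 p : 0 <= f p.
  by rewrite /f patchE; case: ifPn => // /set_mem/sin_chart_ge0.
have mf : measurable_fun setT f.
  apply/(measurable_restrictT _ measurable_chart).
  exact: measurable_sin_chart.
have fE t s : f (t, s) = if (t \in `[0%R, pi]%classic) &&
      (s \in `[0%R, (2 * pi)%R]%classic)
    then (sin t)%:E else 0.
  by rewrite /f patchE in_setX.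
rewrite fubini_tonelli1//.
transitivity (\int[leb]_(t in `[0%R, pi]) ((sin t)%:E * (2 * pi)%:E)).
  rewrite [RHS]integral_mkcond; apply: eq_integral => t _.
  rewrite /fubini_F patchE; case: ifPn => tI.
    transitivity (\int[leb]_(s in `[0%R, (2 * pi)%R]) (cst (sin t)%:E s)).
      rewrite [RHS]integral_mkcond; apply: eq_integral => s _.
      by rewrite [LHS]fE patchE tI.
    rewrite integral_cst//= lebesgue_measure_itv/= lte_fin.
    by rewrite mulr_gt0 ?pi_gt0// oppr0 adde0.
  by apply: integral0_eq => s _; rewrite [LHS]fE (negbTE tI).
rewrite ge0_integralZr//=.
- by rewrite integral_sin_0pi -EFinM; congr EFin; rewrite mulrA -natrM.
- apply/measurable_funTS/measurable_EFinP; exact: measurable_sin.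
- by move=> t; rewrite in_itv/= => t01; rewrite lee_fin sin_ge0_pi.
- by rewrite lee_fin mulr_ge0 ?pi_ge0.
Qed.

Lemma sphere_unif0 : sphere_unif set0 = 0.
Proof. by rewrite /sphere_unif measure0 mule0. Qed.

Lemma sphere_unif_ge0 A : 0 <= sphere_unif A.
Proof.
by rewrite /sphere_unif mule_ge0// lee_fin invr_ge0 mulr_ge0 ?pi_ge0.
Qed.

Lemma sphere_unif_sigma_additive : semi_sigma_additive sphere_unif.
Proof.
move=> F mF tF mUF; rewrite /sphere_unif.
rewrite [X in X @ _ --> _](_ : _ =
    (fun n => ((4 * pi)^-1)%:E * \sum_(0 <= i < n) sphere_area (F i))).
  by apply: cvgeZl => //; exact: measure_semi_sigma_additive.
by apply/funext => n; rewrite ge0_sume_distrr.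
Qed.

HB.instance Definition _ := isMeasure.Build _ _ _ sphere_unif
  sphere_unif0 sphere_unif_ge0 sphere_unif_sigma_additive.

Lemma sphere_unifT : sphere_unif setT = 1.
Proof.
rewrite /sphere_unif sphere_areaT -EFinM mulVf//.
by rewrite mulf_neq0// gt_eqF// pi_gt0.
Qed.

HB.instance Definition _ :=
  Measure_isProbability.Build _ _ _ sphere_unif sphere_unifT.

End uniform_measure.

Section product_power.
Context d (T : measurableType d) {R : realType} (P : probability T R).
Local Open Scope ereal_scope.

Definition tuple_cons n (p : T * n.-tuple T) : n.+1.-tuple T :=
  [the n.+1.-tuple T of p.1 :: p.2].

Lemma measurable_tuple_cons n : measurable_fun setT (@tuple_cons n).
Proof. exact: measurable_cons. Qed.

HB.instance Definition _ n :=
  isMeasurableFun.Build _ _ _ _ (@tuple_cons n) (@measurable_tuple_cons n).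

(* [prob_power n] is the product probability P^(\otimes n), see
   [prob_power_box]. *)
Fixpoint prob_power n : probability (n.-tuple T) R :=
  match n with
  | 0 => dirac [tuple]
  | n'.+1 => distribution (P \x prob_power n') (@tuple_cons n')
  end.

Lemma prob_power_box n (A : 'I_n -> set T) : (forall i, measurable (A i)) ->
  prob_power n [set x | forall i, A i (tnth x i)] = \prod_(i < n) P (A i).
Proof.
elim: n A => [|n IHn] A mA.
  by rewrite big_ord0 /= diracE mem_set// => -[].
rewrite big_ord_recl -(IHn (fun i => A (lift ord0 i)))// -product_measure1E//.
  rewrite /= /distribution /pushforward; congr (product_measure1 _ _ _).
  apply/seteqP; split => [[t x] /= tx|[t x] /= [At Ax] i].
    split; first exact: (tx ord0).
    by move=> i; have := tx (lift ord0 i); rewrite tnthS.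
  by case: (unliftP ord0 i) => [j ->|->//]; rewrite tnthS; exact: Ax.
rewrite (_ : mkset _ = \bigcap_(i in [set: 'I_n])
    ((fun x : n.-tuple T => tnth x i) @^-1` A (lift ord0 i))).
  apply: fin_bigcap_measurable => // i _; rewrite -[X in measurable X]setTI.
  exact: measurable_tnth.
by apply/seteqP; split => x /= xA i; [move=> _|]; apply: xA.
Qed.

End product_power.

Section coulomb_gas.
Context {R : realType} (N : nat).
Implicit Types (x : N.-tuple (sphere R)) (beta : R).
Local Open Scope ereal_scope.

(* In [\bar R], 0^-1 = +oo and lne +oo = +oo, so the energy of a configuration
   with two coinciding points is +oo. *)
Definition log_energy x : \bar R :=
  \sum_(p : 'I_N * 'I_N | p.1 != p.2)
    lne (enorm (sphere_val (tnth x p.1) - sphere_val (tnth x p.2)))%:E^-1.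

(* The infimum is attained, by compactness of the sphere. *)
Definition min_log_energy : \bar R := ereal_inf (range log_energy).

Lemma measurable_expeR : measurable_fun setT (@expeR R).
Proof.
rewrite (_ : @expeR R = fun y : \bar R => if y == +oo then +oo
    else if y == -oo then 0 else (expR (fine y))%:E); last first.
  by apply/funext; case.
have meq (z : \bar R) : measurable_fun setT (fun y : \bar R => y == z).
  apply: (measurable_fun_bool true).
  rewrite setTI (_ : _ @^-1` _ = [set z]); first exact: emeasurable_set1.
  by apply/seteqP; split => y /= /eqP.
apply: measurable_fun_if => //; apply/measurable_funTS.
apply: measurable_fun_if => //; apply/measurable_funTS/measurable_EFinP.
by apply: measurableT_comp => //; exact: fine_measurable.
Qed.

Lemma measurable_log_energy : measurable_fun setT log_energy.
Proof.
rewrite (_ : log_energy = fun x => \sum_(p : 'I_N * 'I_N)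
    if p.1 != p.2 then
      lne (enorm (sphere_val (tnth x p.1) - sphere_val (tnth x p.2)))%:E^-1
    else 0); last by apply/funext => x; rewrite /log_energy big_mkcond.
apply: emeasurable_sum => p; case: (p.1 != p.2) => //.
rewrite (_ : (fun _ => _) = fun x =>
    let r := enorm (sphere_val (tnth x p.1) - sphere_val (tnth x p.2))%R in
    if r == 0%R then +oo else (- ln r)%:E); last first.
  apply/funext => x /=; rewrite inver; case: ifPn => // r0.
  have rp : (0 < enorm (sphere_val (tnth x p.1) - sphere_val (tnth x p.2)))%R.
    by rewrite lt_neqAle eq_sym r0 sqrtr_ge0.
  by rewrite lne_EFin ?invr_gt0// lnV ?posrE.
have mtv i : measurable_fun setT
    (fun x : N.-tuple (sphere R) => sphere_val (tnth x i)).
  apply: (measurableT_comp measurable_sphere_val); exact: measurable_tnth.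
have mr := measurable_enormB (mtv p.1) (mtv p.2).
apply: measurable_fun_if => //.
- exact: measurable_fun_eqr.
- apply/measurable_funTS/measurable_EFinP/measurableT_comp => //.
  exact: measurableT_comp.
Qed.

(* The unnormalized Gibbs measure; [expeR -oo = 0]. *)
Definition boltzmann beta (A : set (N.-tuple (sphere R))) : \bar R :=
  \int[prob_power sphere_unif N]_(x in A) expeR (- (beta%:E * log_energy x)).

Section boltzmann_measure.
Variable beta : R.

Lemma boltzmann0 : boltzmann beta set0 = 0.
Proof. exact: integral_set0. Qed.

Lemma boltzmann_ge0 A : 0 <= boltzmann beta A.
Proof. by apply: integral_ge0 => x _; exact: expeR_ge0. Qed.

Lemma boltzmann_sigma_additive : semi_sigma_additive (boltzmann beta).
Proof.
move=> F mF tF mUF; rewrite /boltzmann; apply: cvg_toP.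
  apply: ereal_nondecreasing_is_cvgn => m n mn.
  by apply: lee_sum_nneg_natr => // k _ _; exact: boltzmann_ge0.
rewrite ge0_integral_bigcup//=; last by move=> x _; exact: expeR_ge0.
apply/measurable_funTS/(measurableT_comp measurable_expeR).
apply: measurableT_comp => //; apply: measurable_funeM.
exact: measurable_log_energy.
Qed.

HB.instance Definition _ := isMeasure.Build _ _ _ (boltzmann beta)
  boltzmann0 boltzmann_ge0 boltzmann_sigma_additive.

End boltzmann_measure.

(* [mnormalize] divides by the partition function Z = [boltzmann beta setT].
   Its last argument is the fallback for Z = 0 or Z = +oo, which plays no role
   for N >= 2 and beta > 0 because then 0 < Z < +oo. *)
Definition coulomb_gas beta : probability (N.-tuple (sphere R)) R :=
  mnormalize (boltzmann beta) (prob_power sphere_unif N).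

End coulomb_gas.

(* Main.v *)
Require Import Defs.
From mathcomp Require Import all_boot all_order all_algebra.
From mathcomp Require Import all_classical all_reals all_analysis.
From mathcomp Require Import measurable_realfun.
From mathcomp Require Import cyclic separable cyclotomic complex.
From mathcomp Require Import ring lra zify.

(**
Both claims follow from the single bound Z >= e^(- beta min H) (beta N^8)^(-N)
on the partition function.  The tail estimate is then Markov's inequality, and
the mean estimate is Gibbs' inequality: with u = beta (H - min H) and
ell = N (log beta + 8 log N), the pointwise bound u + 1 <= ell + e^(u - ell) is
integrated against the Gibbs measure, under which e^u has mean at most e^ell.

To bound Z from below, H is compared with its minimum on a product of caps of
squared radius r of order 1 / (beta N^4) around a minimizer x.  If y is in this
neighbourhood, so is the configuration y' obtained by reflecting every y_i
through x_i, and H(y) - min H <= H(y) + H(y') - 2 min H because H(y') >= min H;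
the first-order terms cancel in the right-hand side, which is at most of order
N^2 r / delta^2 where delta is the minimal distance between points of x.
Finally delta is at least of order N^(-3/2): on the great circle through two
points x_i and x_k, prod_(j != i) |y - x_j|^2 is a trigonometric polynomial of
degree N - 1, maximal at x_i and zero at x_k, and its second differences are
controlled by its Fourier coefficients.  For N = 2 the constants are too tight
for this argument, but x is then a pair of antipodes.
*)

Set Implicit Arguments.
Unset Strict Implicit.
Unset Printing Implicit Defensive.

Import Order.TTheory GRing.Theory Num.Theory.
Import numFieldNormedType.Exports.

Local Open Scope classical_set_scope.
Local Open Scope ring_scope.

(** * Trigonometric polynomials *)

Section trig_poly.
Context (C : numClosedFieldType).
Implicit Types (P : {poly C}) (w z : C).

(** The polynomial X^n - 1 is separable in characteristic zero, so it has n distinct roots; n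
    distinct n-th roots of unity include a primitive one. *)
Lemma prim_root_exists n : (0 < n)%N -> exists z : C, n.-primitive_root z.
Proof.
move=> n0; have [rs] := closed_field_poly_normal ('X^n - 1 : {poly C}).
rewrite (monicP (monicXnsubC 1 n0)) scale1r => rsE.
have rs_uniq : uniq rs.
  rewrite -separable_prod_XsubC -rsE separable_Xn_sub_1 //.
  by rewrite pnatr_eq0 -lt0n.
have rs_size : size rs = n.
  by apply: succn_inj; rewrite -(size_prod_XsubC rs id) -rsE size_XnsubC.
have rs_root : all n.-unity_root rs.
  by apply/allP => z; rewrite -root_prod_XsubC -rsE.
have := has_prim_root n0 rs_root rs_uniq; rewrite rs_size leqnn.
by case/(_ isT)/hasP => z _; exists z.
Qed.

Lemma sum_unity_root n w : w ^+ n = 1 -> w != 1 -> \sum_(k < n) w ^+ k = 0.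
Proof.
move=> wn w1; apply: (mulfI (x := w - 1)); first by rewrite subr_eq0.
by rewrite -subrX1 wn subrr mulr0.
Qed.

(** Fourier inversion on the n-th roots of unity. The size bound excludes aliasing: two exponents
    below n that agree modulo n are equal, so every other coefficient meets a vanishing geometric
    sum. *)
Lemma coef_prim_root n z P m : n.-primitive_root z -> (size P <= n)%N ->
  (m < n)%N ->
  P`_m *+ n = \sum_(k < n) P.[z ^+ k] * z ^- m ^+ k.
Proof.
move=> pz sP mn.
have z0 : z != 0.
  apply/eqP => z0; have /eqP := prim_expr_order pz.
  by rewrite z0 expr0n (gtn_eqF (leq_ltn_trans (leq0n m) mn)) eq_sym oner_eq0.
under eq_bigr do rewrite (horner_coef_wide _ sP) mulr_suml.
rewrite exchange_big /=.
have nz : (z ^- m) ^+ n = 1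
  by rewrite -exprVn -exprM mulnC exprM exprVn (prim_expr_order pz) invr1 expr1n.
transitivity (\sum_(l < n) P`_l * \sum_(k < n) (z ^+ l * z ^- m) ^+ k).
  rewrite (bigD1 (Ordinal mn)) //= [X in _ + X]big1 ?addr0 => [|l lm].
    under eq_bigr => i _ do rewrite mulfV ?expf_neq0 // expr1n.
    by rewrite sumr_const card_ord mulr_natr.
  rewrite sum_unity_root ?mulr0 //.
    by rewrite exprMn nz mulr1 -exprM mulnC exprM (prim_expr_order pz) expr1n.
  apply: contra lm => /eqP /(congr1 ( *%R^~ (z ^+ m))).
  rewrite mulfVK ?expf_neq0 // mul1r => /eqP.
  rewrite (eq_prim_root_expr pz) !modn_small //.
apply: eq_bigr => l _; rewrite mulr_sumr; apply: eq_bigr => k _.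
by rewrite exprMn -!exprM mulnC -mulrA.
Qed.

Lemma coef_le_max P K m :
  (forall w, `|w| = 1 -> `|P.[w]| <= K) -> `|P`_m| <= K.
Proof.
move=> PK.
have K0 : 0 <= K by apply: le_trans (PK 1 (normr1 _)).
have [mP|Pm] := ltnP m (size P); last by rewrite nth_default ?normr0.
have n0 := leq_trans (ltn0Sn m) mP; set n := size P in n0 mP.
have [z pz] := prim_root_exists n0.
have z1 : `|z| = 1.
  apply/eqP; rewrite -(pexpr_eq1 n0) // -normrX (prim_expr_order pz).
  by rewrite normr1.
have nC0 : (0 : C) < n%:R by rewrite ltr0n.
rewrite -(ler_pM2r nC0) -{1}[n%:R]normr_nat -normrM mulr_natr.
rewrite (coef_prim_root pz (leqnn _) mP) (le_trans (ler_norm_sum _ _ _)) //.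
rewrite -[n in _ * n%:R]card_ord mulr_natr -sumr_const ler_sum // => k _.
rewrite normrM !normrX normfV normrX z1 !expr1n invr1 expr1n mulr1 PK //.
by rewrite normrX z1 expr1n.
Qed.

(** On the unit circle w^-n P(w) has frequencies m - n between -n and n; this is the sum of their
    squares, the constant in the bound on second differences at 1. *)
Definition second_moment n : C := \sum_(m < n.*2.+1) (m%:R - n%:R) ^+ 2.

Lemma norm_1subX w k : `|w| = 1 -> `|1 - w ^+ k| <= k%:R * `|1 - w|.
Proof.
move=> w1; rewrite -(opprB (w ^+ k)) normrN subrX1 normrM mulrC distrC.
rewrite ler_wpM2r // (le_trans (ler_norm_sum _ _ _)) //.
under eq_bigr do rewrite normrX w1 expr1n.
by rewrite sumr_const card_ord.
Qed.

Lemma norm1V w : `|w| = 1 -> `|w^-1| = 1.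
Proof. by move=> w1; rewrite normfV w1 invr1. Qed.

(** With k = |m - n| the left-hand side is the modulus of (1 - w^k)(1 - w^-k), and each factor is at
    most k |1 - w|. *)
Lemma norm_second_difference w n m : `|w| = 1 ->
  `|2 - w ^- n * w ^+ m - w ^+ n * w ^- m| <= (m%:R - n%:R) ^+ 2 * `|1 - w| ^+ 2.
Proof.
move=> w1.
have w0 : w != 0 by rewrite -normr_gt0 w1.
wlog nm : n m / (n <= m)%N => [H|].
  case/orP: (leq_total n m) => [|mn]; first exact: H.
  by have := H _ _ mn; rewrite -(opprB n%:R) sqrrN addrAC ![_ * w ^- _]mulrC.
have -> : 2 - w ^- n * w ^+ m - w ^+ n * w ^- m =
    (1 - w ^+ (m - n)) * (1 - w^-1 ^+ (m - n)).
  rewrite exprVn mulrBl mul1r mulrBr mulr1 divff ?expf_neq0 //.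
  by rewrite expfB_cond ?(negbTE w0) //= invf_div; ring.
rewrite -natrB // normrM expr2 mulrACA ler_pM //.
  exact: norm_1subX.
rewrite (le_trans (norm_1subX _ (norm1V w1))) //.
have -> : 1 - w^-1 = - w^-1 * (1 - w) by field.
by rewrite normrM normrN norm1V // mul1r.
Qed.

(* The coefficients of [P] are at most [K] in modulus, as averages of
   [w^-m * P.[w]] over roots of unity. *)
Lemma second_difference_le P K n w : (size P <= n.*2.+1)%N ->
  (forall u, `|u| = 1 -> `|P.[u]| <= K) -> `|w| = 1 ->
  `|2 * P.[1] - w ^- n * P.[w] - w ^+ n * P.[w^-1]| <=
  K * `|1 - w| ^+ 2 * second_moment n.
Proof.
move=> sP PK w1.
have -> : 2 * P.[1] - w ^- n * P.[w] - w ^+ n * P.[w^-1] =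
    \sum_(m < n.*2.+1) P`_m * (2 - w ^- n * w ^+ m - w ^+ n * w ^- m).
  rewrite !(horner_coef_wide _ sP) !mulr_sumr -!sumrB.
  by apply: eq_bigr => m _; rewrite expr1n exprVn; ring.
rewrite (le_trans (ler_norm_sum _ _ _)) // mulr_sumr ler_sum // => m _.
rewrite normrM -mulrA ler_pM //; first exact: coef_le_max.
by rewrite [leRHS]mulrC norm_second_difference.
Qed.

Lemma second_momentE n :
  3 * second_moment n = (n * n.+1 * n.*2.+1)%:R.
Proof.
rewrite /second_moment.
(* The induction runs on the number of terms with the centre [a] fixed; the lemma is the case of 2n
   + 1 terms centred at n. *)
have H (k : nat) (a : C) : 6 * \sum_(m < k) (m%:R - a) ^+ 2 =
   k%:R * ((k%:R - 1) * (2 * k%:R - 1) - 6 * a * (k%:R - 1) + 6 * a ^+ 2).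
  elim: k => [|k IH]; first by rewrite big_ord0 mulr0 mul0r.
  by rewrite big_ord_recr /= mulrDr IH -natr1; ring.
apply: (mulfI (x := 2)); first by rewrite pnatr_eq0.
rewrite mulrA -natrM H -muln2 !natrM -!natr1 natrM; ring.
Qed.

End trig_poly.

(** * Distance between a maximum and a zero on the circle *)

Section great_circle.
Local Open Scope complex_scope.

(** Let Q be the maximum. Subtracting Q/2 from [q] makes its sup norm Q/2. The second difference at
    1 with step w = c + is is 2Q - q(c, -s), hence at least Q, since [q] vanishes at w and is at
    most Q at the conjugate of w. The Fourier bound (Q/2) |1 - w|^2 n(n+1)(2n+1)/3 then gives the
    claim after division by Q. *)
Lemma circle_max_zero_separated (R : rcfType) n (a b : 'I_n -> R) (c s : R) :
  let q u v : R := \prod_j (2 - 2 * (u * a j + v * b j)) in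
  (forall u v, u ^+ 2 + v ^+ 2 = 1 -> 0 <= q u v <= q 1 0) -> 0 < q 1 0 ->
  c ^+ 2 + s ^+ 2 = 1 -> q c s = 0 ->
  6 <= (2 - 2 * c) * (n * n.+1 * n.*2.+1)%:R.
Proof.
move=> q qle q0 cs1 qcs; set Q := q 1 0 in qle q0.
(* For w = u + iv of modulus 1 and alpha = a + ib, the real number 2(ua + vb) is w conj(alpha) +
   conj(w) alpha, so [L j] evaluates to w times the j-th factor of [q]. *)
pose L j : {poly R[i]} := 2 *: 'X - (a j -i* b j) *: 'X^2 - (a j +i* b j)%:P.
pose P : {poly R[i]} := \prod_j L j - (Q / 2)%:C *: 'X^n.
have sL j : (size (L j) <= 3)%N.
  rewrite !(leq_trans (size_polyD _ _)) // geq_max size_polyN; apply/andP; split.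
    rewrite (leq_trans (size_polyD _ _)) // geq_max size_polyN.
    by rewrite !(leq_trans (size_scale_leq _ _)) ?size_polyX ?size_polyXn.
  by rewrite (leq_trans (size_polyC_leq1 _)).
have sP : (size P <= n.*2.+1)%N.
  rewrite (leq_trans (size_polyD _ _)) // geq_max size_polyN; apply/andP; split.
    rewrite (leq_trans (size_prod_leq _ _)) //= card_ord leq_subLR.
    have : (\sum_(i < n) size (L i) <= \sum_(i < n) 3)%N by exact: leq_sum.
    rewrite sum_nat_const card_ord; move: (\sum_(i < n) _)%N => S; lia.
  by rewrite (leq_trans (size_scale_leq _ _)) // size_polyXn -addnn; lia.
have PE u v : u ^+ 2 + v ^+ 2 = 1 ->
    P.[u +i* v] = (u +i* v) ^+ n * (q u v - Q / 2)%:C.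
  move=> uv; rewrite hornerD horner_prod hornerN hornerZ hornerXn.
  rewrite rmorphB /= mulrBr [_%:C * _]mulrC; congr (_ - _).
  rewrite rmorph_prod /= -[X in _ ^+ X]card_ord -prodr_const -big_split /=.
  apply: eq_bigr => j _; rewrite !hornerE; apply/eqP; simpc.
  rewrite eq_complex /=; apply/andP; split; apply/eqP.
    have : a j * (u ^+ 2 + v ^+ 2) = a j by rewrite uv mulr1.
    by lra.
  have : b j * (u ^+ 2 + v ^+ 2) = b j by rewrite uv mulr1.
  by lra.
have circ (w : R[i]) : `|w| = 1 -> exists u v : R, w = u +i* v /\ u ^+ 2 + v ^+ 2 = 1.
  case: w => u v; rewrite normc_def /= => -[/eqP].
  rewrite -[_ == 1]sqrp_eq1 ?sqrtr_ge0 // sqr_sqrtr ?addr_ge0 ?sqr_ge0 //.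
  by move=> /eqP; exists u, v.
have norm_uv (u v : R) : u ^+ 2 + v ^+ 2 = 1 -> `|u +i* v| = 1.
  by move=> uv; rewrite normc_def uv sqrtr1.
have PQ (w : R[i]) : `|w| = 1 -> `|P.[w]| <= (Q / 2)%:C.
  move=> w1; have [u [v [wE uv]]] := circ _ w1.
  rewrite wE PE // normrM normrX norm_uv // expr1n mul1r normc_def /=.
  rewrite expr0n addr0 sqrtr_sqr lecR ler_norml.
  by have /andP[] := qle _ _ uv; lra.
have w1 := norm_uv _ _ cs1.
have := second_difference_le sP PQ w1.
have one1 : 1 = 1 +i* 0 :> R[i] by [].
have cs1' : c ^+ 2 + (- s) ^+ 2 = 1 by rewrite sqrrN.
have wV : (c +i* s)^-1 = c -i* s.
  by apply/eqP; rewrite eq_complex /= cs1 !divr1 !eqxx.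
have wn0 : (c +i* s) ^+ n != 0 by rewrite expf_neq0 // -normr_gt0 w1.
have -> : P.[1] = (Q / 2)%:C.
  have := @PE 1 0; rewrite -one1 expr0n addr0 !expr1n mul1r => -> //.
  by congr _%:C; rewrite -/Q; lra.
have -> : (c +i* s) ^- n * P.[c +i* s] = (- (Q / 2))%:C.
  by rewrite PE // qcs add0r mulKf.
have -> : (c +i* s) ^+ n * P.[(c +i* s)^-1] = (q c (- s) - Q / 2)%:C.
  by rewrite wV PE // -wV exprVn mulVKf.
have -> : `|1 - (c +i* s)| ^+ 2 = (2 - 2 * c)%:C.
  by rewrite -add_Re2_Im2 /=; congr _%:C; move: cs1; lra.
have -> : second_moment R[i] n = ((n * n.+1 * n.*2.+1)%:R / 3)%:C.
  apply: (mulfI (x := 3)); first by rewrite pnatr_eq0.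
  rewrite second_momentE -[3]/(3%:R) -(rmorph_nat (real_complex R) 3).
  by rewrite -rmorphM mulrC divfK ?pnatr_eq0 // rmorph_nat.
rewrite -[2 * _]/(2%:R * _) -(rmorph_nat (real_complex R) 2).
rewrite -!rmorphM -!rmorphB /= normc_def /= expr0n addr0 sqrtr_sqr lecR.
have /andP[_] := qle _ _ cs1'; set q' := q c (- s) => q'Q.
move=> /(le_trans (ler_norm _)); set S := (n * _ * _)%:R => H.
rewrite -(ler_pM2l q0); lra.
Qed.

End great_circle.

(** * Chords and reflections *)

Section sphere_geometry.
Context {R : realType}.
Implicit Types (a b : R * R * R) (x y z : sphere R).

Definition dot a b : R := a.1.1 * b.1.1 + a.1.2 * b.1.2 + a.2 * b.2.

Definition scal (c : R) a : R * R * R := (c * a.1.1, c * a.1.2, c * a.2).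

Definition sqdist x y : R := enorm (sphere_val x - sphere_val y) ^+ 2.

Lemma enorm_ge0 a : 0 <= enorm a.
Proof. exact: sqrtr_ge0. Qed.

Lemma sqr_enorm a : enorm a ^+ 2 = dot a a.
Proof. by rewrite sqr_sqrtr ?addr_ge0 ?sqr_ge0 // /dot !expr2. Qed.

Lemma enorm_eq1 a : (enorm a == 1) = (dot a a == 1).
Proof. by rewrite -sqr_enorm sqrp_eq1 ?enorm_ge0. Qed.

Lemma dot_sphere x : dot (sphere_val x) (sphere_val x) = 1.
Proof. by apply/eqP; rewrite -enorm_eq1; exact: (valP x). Qed.

Definition sphere_of a (a1 : dot a a = 1) : sphere R :=
  exist _ a (etrans (enorm_eq1 a) (introT eqP a1)).

Lemma sphere_ofE a (a1 : dot a a = 1) : sphere_val (sphere_of a1) = a.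
Proof. by []. Qed.

Lemma sphere_eq x y : sphere_val x = sphere_val y -> x = y.
Proof. by move=> h; exact: val_inj. Qed.

Lemma sqdistE x y : sqdist x y = 2 - 2 * dot (sphere_val x) (sphere_val y).
Proof.
rewrite /sqdist sqr_enorm; have := dot_sphere x; have := dot_sphere y.
by rewrite /dot /=; lra.
Qed.

Lemma sqdist_ge0 x y : 0 <= sqdist x y.
Proof. exact: sqr_ge0. Qed.

Lemma sqdistC x y : sqdist x y = sqdist y x.
Proof. by rewrite !sqdistE /dot; lra. Qed.

Lemma sqdistxx x : sqdist x x = 0.
Proof. by rewrite sqdistE dot_sphere; lra. Qed.

Lemma dot_eq1 x y : dot (sphere_val x) (sphere_val y) = 1 -> x = y.
Proof.
move=> xy; apply: sphere_eq; have := dot_sphere x; have := dot_sphere y.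
move: xy; case: (sphere_val x) (sphere_val y) => [[x1 x2] x3] [[y1 y2] y3].
rewrite /dot /= => xy yy xx.
have : (x1 - y1) ^+ 2 + (x2 - y2) ^+ 2 + (x3 - y3) ^+ 2 = 0 by lra.
move/eqP; rewrite !paddr_eq0 ?addr_ge0 ?sqr_ge0 // !sqrf_eq0 !subr_eq0.
by move=> /andP[/andP[/eqP -> /eqP ->] /eqP ->].
Qed.

Lemma dot_sphere_ge x y : -1 <= dot (sphere_val x) (sphere_val y).
Proof.
have := dot_sphere x; have := dot_sphere y.
case: (sphere_val x) (sphere_val y) => [[x1 x2] x3] [[y1 y2] y3].
have := sqr_ge0 (x1 + y1); have := sqr_ge0 (x2 + y2).
by have := sqr_ge0 (x3 + y3); rewrite /dot /=; lra.
Qed.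

Lemma dot_sphere_le x y : dot (sphere_val x) (sphere_val y) <= 1.
Proof. by have := sqdist_ge0 x y; rewrite sqdistE; lra. Qed.

Lemma circle_subproof (x e : R * R * R) (u v : R) :
  dot x x = 1 -> dot e e = 1 -> dot x e = 0 -> u ^+ 2 + v ^+ 2 = 1 ->
  dot (scal u x + scal v e) (scal u x + scal v e) = 1.
Proof.
move=> xx ee xe uv.
transitivity (u ^+ 2 * dot x x + v ^+ 2 * dot e e + 2 * u * v * dot x e).
  by rewrite /dot /scal /=; ring.
by rewrite xx ee xe; lra.
Qed.

(* On the great circle through [x] and [y k], the product is a trigonometric
   polynomial of degree [n], maximal at [x] and vanishing at [y k]. *)
Lemma maximizer_separated n x (y : 'I_n -> sphere R) k :
  (forall z, \prod_j sqdist z (y j) <= \prod_j sqdist x (y j)) ->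
  0 < \prod_j sqdist x (y j) ->
  6 <= sqdist x (y k) * (n * n.+1 * n.*2.+1)%:R.
Proof.
move=> xmax x0; set X := sphere_val x.
have xx : dot X X = 1 := dot_sphere x.
set Y := fun j => sphere_val (y j); set c := dot X (Y k).
have cle1 : c <= 1 := dot_sphere_le x (y k).
have cgeN1 : -1 <= c := dot_sphere_ge x (y k).
have c1 : c != 1.
  apply: contraTneq x0 => /dot_eq1 xk.
  by rewrite (bigD1 k) //= -xk sqdistxx mul0r ltxx.
(* Antipodal points do not determine a great circle, but their squared distance 4 is more than
   enough. *)
have [cN1|cN1] := eqVneq c (-1).
  have n0 : (0 < n)%N := leq_ltn_trans (leq0n k) (ltn_ord k).
  rewrite sqdistE -/c cN1 (_ : 2 - 2 * -1 = 4%:R); last by lra.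
  by rewrite -natrM ler_nat; nia.
have s0 : 0 < 1 - c ^+ 2.
  have : -1 < c by rewrite lt_neqAle eq_sym cN1.
  have : c < 1 by rewrite lt_neqAle c1.
  by nra.
set s := Num.sqrt (1 - c ^+ 2).
have sp : 0 < s by rewrite sqrtr_gt0.
have ss : s ^+ 2 = 1 - c ^+ 2 by rewrite sqr_sqrtr // ltW.
(* Gram-Schmidt: [e] completes [X] to an orthonormal basis of the plane of the great circle, in
   which [Y k] has coordinates (c, s). *)
pose e := scal s^-1 (Y k - scal c X).
have yy : dot (Y k) (Y k) = 1 := dot_sphere (y k).
have xe : dot X e = 0.
  transitivity (s^-1 * (c - c * dot X X)); last by rewrite xx; ring.
  by rewrite /e /c /dot /scal /=; ring.
have ee : dot e e = 1.
  transitivity ((dot (Y k) (Y k) - 2 * c * c + c ^+ 2 * dot X X) / s ^+ 2).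
    by rewrite /e /c /dot /scal /=; field; rewrite gt_eqF.
  by rewrite yy xx ss; field; rewrite gt_eqF.
rewrite sqdistE -/X -/(Y k) -/c.
pose p u v (uv : u ^+ 2 + v ^+ 2 = 1) := sphere_of (circle_subproof xx ee xe uv).
have pE u v uv : \prod_j sqdist (@p u v uv) (y j) =
    \prod_j (2 - 2 * (u * dot X (Y j) + v * dot e (Y j))).
  apply: eq_bigr => j _; rewrite sqdistE; congr (2 - 2 * _).
  rewrite sphere_ofE -/(Y j) /dot /scal /=; ring.
have uv10 : 1 ^+ 2 + 0 ^+ 2 = 1 :> R by rewrite expr1n expr0n addr0.
have p10 : p _ _ uv10 = x.
  apply: sphere_eq; rewrite sphere_ofE /scal -/X [RHS]surjective_pairing.
  by rewrite [X.1 in RHS]surjective_pairing; congr (_, _, _) => /=; ring.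
have cs : c ^+ 2 + s ^+ 2 = 1 by rewrite ss; ring.
have pcs : p _ _ cs = y k.
  apply: sphere_eq; rewrite sphere_ofE -/(Y k) /e /scal.
  rewrite [RHS]surjective_pairing [(Y k).1 in RHS]surjective_pairing.
  by congr (_, _, _) => /=; field; rewrite gt_eqF.
apply: (@circle_max_zero_separated _ _ (fun j => dot X (Y j))
  (fun j => dot e (Y j)) c s) => //.
- move=> u v uv; rewrite -!pE p10 xmax andbT.
  by apply: prodr_ge0 => j _; exact: sqdist_ge0.
- by rewrite -pE p10.
- by rewrite -pE pcs (bigD1 k) //= sqdistxx mul0r.
Qed.

Lemma reflect_subproof x y : let a := sphere_val x in let b := sphere_val y in
  dot (scal (2 * dot a b) a - b) (scal (2 * dot a b) a - b) = 1.
Proof.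
move=> a b; transitivity (4 * dot a b ^+ 2 * (dot a a - 1) + dot b b).
  by rewrite /dot /scal /=; ring.
by rewrite !dot_sphere; ring.
Qed.

(** The half turn about the axis through x: it keeps the component of y along x and negates the
    orthogonal one. *)
Definition reflect_at x y : sphere R := sphere_of (reflect_subproof x y).

(** Split each y_i into its component c_i x_i and an orthogonal part h_i, which the reflection
    negates. With d = c_1 x_1 - c_2 x_2 and f = h_1 - h_2, the two squared distances are |d + f|^2
    and |d - f|^2, whose product is at least (|d|^2 - |f|^2)^2 by Cauchy-Schwarz. Here |d|^2 >= (1 -
    r) D and |f|^2 <= 4r <= (4r/e) D, where D is the squared distance of x_1 and x_2. *)
Lemma sqdist_reflect_ge (r e : R) x1 x2 y1 y2 :
  sqdist x1 y1 <= r -> sqdist x2 y2 <= r -> 0 < e -> e <= sqdist x1 x2 ->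
  r + 4 * r / e <= 1 ->
  (sqdist x1 x2 * (1 - (r + 4 * r / e))) ^+ 2 <=
    sqdist y1 y2 * sqdist (reflect_at x1 y1) (reflect_at x2 y2).
Proof.
move=> xy1 xy2 e0 ex L1; set D := sqdist x1 x2 in ex *.
have r0 : 0 <= r := le_trans (sqdist_ge0 _ _) xy1.
set q := 4 * r / e in L1 *.
have q0 : 0 <= q by apply: divr_ge0; [exact: mulr_ge0|exact: ltW].
have qe : 4 * r <= q * D.
  by rewrite -(divfK (lt0r_neq0 e0) (4 * r)) ler_wpM2l.
set a1 := sphere_val x1; set a2 := sphere_val x2.
set b1 := sphere_val y1; set b2 := sphere_val y2.
set c1 := dot a1 b1; set c2 := dot a2 b2.
have c1r : 2 - 2 * c1 <= r by rewrite -sqdistE.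
have c2r : 2 - 2 * c2 <= r by rewrite -sqdistE.
have c11 : c1 <= 1 := dot_sphere_le x1 y1.
have c21 : c2 <= 1 := dot_sphere_le x2 y2.
pose d := scal c1 a1 - scal c2 a2.
pose f := (b1 - scal c1 a1) - (b2 - scal c2 a2).
have -> : sqdist y1 y2 = dot d d + dot f f + 2 * dot d f.
  by rewrite /sqdist sqr_enorm -/b1 -/b2 /d /f /dot /scal /=; ring.
have -> : sqdist (reflect_at x1 y1) (reflect_at x2 y2) =
    dot d d + dot f f - 2 * dot d f.
  rewrite /sqdist sqr_enorm !sphere_ofE -/a1 -/a2 -/b1 -/b2 -/c1 -/c2 /d /f.
  by rewrite /dot /scal /=; ring.
have DE : D = 2 - 2 * dot a1 a2 by exact: sqdistE.
have aa1 : dot a1 a1 = 1 := dot_sphere x1.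
have aa2 : dot a2 a2 = 1 := dot_sphere x2.
have bb1 : dot b1 b1 = 1 := dot_sphere y1.
have bb2 : dot b2 b2 = 1 := dot_sphere y2.
have dd : dot d d = (c1 - c2) ^+ 2 + c1 * c2 * D.
  transitivity (c1 ^+ 2 * dot a1 a1 + c2 ^+ 2 * dot a2 a2 -
     2 * c1 * c2 * dot a1 a2); first by rewrite /d /dot /scal /=; ring.
  by rewrite DE aa1 aa2; ring.
have ff : dot f f <= 4 * r.
  pose h1 := b1 - scal c1 a1; pose h2 := b2 - scal c2 a2.
  have hh1 : dot h1 h1 = 1 - c1 ^+ 2.
    transitivity (dot b1 b1 - 2 * c1 * c1 + c1 ^+ 2 * dot a1 a1).
      by rewrite /h1 /c1 /dot /scal /=; ring.
    by rewrite aa1 bb1; ring.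
  have hh2 : dot h2 h2 = 1 - c2 ^+ 2.
    transitivity (dot b2 b2 - 2 * c2 * c2 + c2 ^+ 2 * dot a2 a2).
      by rewrite /h2 /c2 /dot /scal /=; ring.
    by rewrite aa2 bb2; ring.
  have : dot f f <= 2 * dot h1 h1 + 2 * dot h2 h2.
    rewrite -subr_ge0 (_ : _ - _ = dot (h1 + h2) (h1 + h2)).
      by rewrite -sqr_enorm sqr_ge0.
    by rewrite /f -/h1 -/h2 /dot /=; ring.
  by rewrite hh1 hh2; nra.
have ff0 : 0 <= dot f f by rewrite -sqr_enorm sqr_ge0.
have CS : dot d f ^+ 2 <= dot d d * dot f f.
  (* Lagrange's identity: the difference is the squared norm of the cross product of [d] and [f]. *)
  rewrite -subr_ge0 (_ : _ - _ =
    (d.1.1 * f.1.2 - d.1.2 * f.1.1) ^+ 2 + (d.1.1 * f.2 - d.2 * f.1.1) ^+ 2 +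
    (d.1.2 * f.2 - d.2 * f.1.2) ^+ 2).
    by rewrite !addr_ge0 ?sqr_ge0.
  by rewrite /dot; ring.
have D0 : 0 <= D by exact: sqdist_ge0.
have cc : 1 - r <= c1 * c2 by nra.
have ge : D * (1 - (r + q)) <= dot d d - dot f f.
  have : (1 - r) * D <= c1 * c2 * D by rewrite ler_wpM2r.
  by have := sqr_ge0 (c1 - c2); rewrite dd; lra.
have ge0 : 0 <= D * (1 - (r + q)) by rewrite mulr_ge0 // subr_ge0.
apply: le_trans (_ : (dot d d - dot f f) ^+ 2 <= _).
  by rewrite lerXn2r ?nnegrE // (le_trans ge0).
by move: CS; lra.
Qed.

End sphere_geometry.

(** * Maximizers of the product of distances *)

Lemma ln_prod (R : realType) (I : finType) (P : pred I) (F : I -> R) :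
  (forall i, P i -> 0 < F i) ->
  ln (\prod_(i | P i) F i) = \sum_(i | P i) ln (F i).
Proof.
move=> F0.
suff [] : 0 < \prod_(i | P i) F i /\
  ln (\prod_(i | P i) F i) = \sum_(i | P i) ln (F i) by [].
apply: (big_ind2 (fun a b : R => 0 < a /\ ln a = b)).
- by rewrite ln1.
- by move=> a s b t [a0 <-] [b0 <-]; rewrite mulr_gt0 // lnM.
- by move=> i Pi; rewrite F0.
Qed.

Section pair_product.
Context {R : realType} {N : nat}.
Implicit Types (x y : N.-tuple (sphere R)).

(** The energy is minus half the logarithm of this product, so its minimizers are the maximizers
    here; the product stays finite and continuous where points collide. *)
Definition pair_prod x : R :=
  \prod_(p : 'I_N * 'I_N | p.1 != p.2) sqdist (tnth x p.1) (tnth x p.2).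

Lemma pair_prod_ge0 x : 0 <= pair_prod x.
Proof. by apply: prodr_ge0 => p _; exact: sqdist_ge0. Qed.

Lemma log_energyE x : log_energy x =
  if pair_prod x == 0 then +oo%E else (- (ln (pair_prod x) / 2))%:E.
Proof.
pose d (p : 'I_N * 'I_N) := sqdist (tnth x p.1) (tnth x p.2).
have dE p :
    lne (enorm (sphere_val (tnth x p.1) - sphere_val (tnth x p.2)))%:E^-1%E =
    if d p == 0 then +oo%E else (- (ln (d p) / 2))%:E.
  rewrite /d /sqdist; set r := enorm _.
  have r0 : 0 <= r by exact: enorm_ge0.
  rewrite inver sqrf_eq0; case: ifPn => // rn0.
  have rp : 0 < r by rewrite lt_neqAle eq_sym rn0.
  rewrite lne_EFin ?invr_gt0 // lnV ?posrE // lnXn //.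
  by congr _%:E; lra.
rewrite /log_energy (eq_bigr _ (fun p _ => dE p)).
have [[p pp d0]|nd0] := pselect (exists2 p, p.1 != p.2 & d p = 0).
  rewrite (_ : pair_prod x = 0) ?eqxx; last first.
    by apply/eqP/prodf_eq0; exists p => //; exact/eqP.
  (* No term is -oo, so the term +oo absorbs the rest of the sum. *)
  rewrite (bigD1 p) //= d0 eqxx addye //; apply/eqP => /esum_eqNyP.
  by move=> [q [_ [_]]]; case: ifP.
have dn0 p : p.1 != p.2 -> d p != 0.
  by move=> pp; apply/eqP => d0; apply: nd0; exists p.
rewrite (negbTE (_ : pair_prod x != 0)); last first.
  by apply/prodf_neq0 => p /dn0.
rewrite (eq_bigr (fun p => (- (ln (d p) / 2))%:E)); last first.
  by move=> p /dn0/negbTE ->.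
rewrite sumEFin; congr _%:E; rewrite sumrN -mulr_suml; congr (- (_ / _)).
by rewrite /pair_prod ln_prod // => p /dn0 dp; rewrite lt_neqAle eq_sym dp sqdist_ge0.
Qed.

Lemma expe_log_energy (b : R) x : 0 < b ->
  expeR (- (b%:E * log_energy x)) = (pair_prod x `^ (b / 2))%:E.
Proof.
move=> b0; rewrite log_energyE /powR; case: ifPn => [_|x0].
  by rewrite gt0_muley //= gt_eqF // divr_gt0.
by rewrite -EFinM -EFinN /=; congr (expR _)%:E; lra.
Qed.

(** Isolates the dependence on the i-th point: each pair containing it occurs in both orders, hence
    the square, and the second factor does not involve it. *)
Lemma pair_prod_split (i : 'I_N) x : pair_prod x =
  (\prod_(j | j != i) sqdist (tnth x i) (tnth x j)) ^+ 2 *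
  \prod_(k | k != i) \prod_(j | (j != k) && (j != i)) sqdist (tnth x k) (tnth x j).
Proof.
rewrite /pair_prod -(pair_big_dep xpredT (fun i j : 'I_N => i != j)
  (fun i j => sqdist (tnth x i) (tnth x j))) /= (bigD1 i) //=.
under eq_bigl do rewrite eq_sym.
rewrite expr2 -mulrA; congr (_ * _); rewrite -big_split /=.
apply: eq_bigr => k ki; rewrite (bigD1 i) //= sqdistC; congr (_ * _).
by apply: eq_bigl => j; rewrite eq_sym.
Qed.

(** Moving only the i-th point leaves the second factor of [pair_prod_split] unchanged, and this
    factor is positive, so it cancels. *)
Lemma maximizer_tnth x (i : 'I_N) z :
  (forall y, pair_prod y <= pair_prod x) -> 0 < pair_prod x ->
  \prod_(j | j != i) sqdist z (tnth x j) <=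
  \prod_(j | j != i) sqdist (tnth x i) (tnth x j).
Proof.
move=> xmax x0; pose y := [tuple if k == i then z else tnth x k | k < N].
have yi : tnth y i = z by rewrite tnth_mktuple eqxx.
have yj j : j != i -> tnth y j = tnth x j by rewrite tnth_mktuple => /negbTE ->.
have := xmax y; rewrite !(pair_prod_split i) yi.
rewrite (eq_bigr (fun j => sqdist z (tnth x j))); last by move=> j /yj ->.
rewrite [X in _ * X <= _](eq_bigr (fun k => \prod_(j | (j != k) && (j != i))
   sqdist (tnth x k) (tnth x j))); last first.
  by move=> k /yj ->; apply: eq_bigr => j /andP[_ /yj ->].
move: x0; rewrite (pair_prod_split i); set A := \prod_(j | _) _.
set B := \prod_(k | _) _; set C := \prod_(j | _) _ => AB0.
have A0 : 0 <= A by apply: prodr_ge0 => *; exact: sqdist_ge0.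
have C0 : 0 <= C by apply: prodr_ge0 => *; exact: sqdist_ge0.
have B0 : 0 < B.
  rewrite lt_neqAle prodr_ge0 ?andbT; last first.
    by move=> k _; apply: prodr_ge0 => *; exact: sqdist_ge0.
  by apply: contraTneq AB0 => <-; rewrite mulr0 ltxx.
by rewrite ler_pM2r // ler_pXn2r.
Qed.

Lemma prod_lift (i : 'I_N) (F : 'I_N -> R) :
  \prod_(j < N.-1) F (lift i j) = \prod_(j | j != i) F j.
Proof.
rewrite [RHS](reindex_omap (lift i) (unlift i)) /=.
  by apply: eq_bigl => j; rewrite liftK eq_sym neq_lift eqxx.
by move=> j; case: unliftP => [k ->|->]; rewrite ?eqxx.
Qed.

(** Each point of a maximizer maximizes the product of distances to the other N - 1 points, so
    [maximizer_separated] applies with n = N - 1. *)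
Lemma maximizer_pairs_separated x (i k : 'I_N) :
  (forall y, pair_prod y <= pair_prod x) -> 0 < pair_prod x -> k != i ->
  6 <= sqdist (tnth x i) (tnth x k) * (N.-1 * N.-1.+1 * N.-1.*2.+1)%:R.
Proof.
move=> xmax x0 ki.
have opt z : \prod_(j < N.-1) sqdist z (tnth x (lift i j)) <=
    \prod_(j < N.-1) sqdist (tnth x i) (tnth x (lift i j)).
  by rewrite !(prod_lift i (fun j => sqdist _ (tnth x j))) maximizer_tnth.
case: (unliftP i k) ki => [j ->|->]; last by rewrite eqxx.
move=> _; apply: (maximizer_separated (y := fun j => tnth x (lift i j))) => //.
move: x0; rewrite (pair_prod_split i) (prod_lift i (fun j => sqdist _ (tnth x j))).
set A := \prod_(j | _) _ => A0.
rewrite lt_neqAle prodr_ge0 ?andbT => [|l _]; last exact: sqdist_ge0.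
by apply: contraTneq A0 => <-; rewrite expr0n mul0r ltxx.
Qed.

Lemma prod_pairs_const (c : R) :
  \prod_(p : 'I_N * 'I_N | p.1 != p.2) c = c ^+ (N * N.-1).
Proof.
rewrite -(pair_big_dep xpredT (fun i j : 'I_N => i != j) (fun _ _ => c)) /=.
rewrite (eq_bigr (fun _ => c ^+ N.-1)) => [|i _]; last first.
  rewrite (eq_bigl (predC1 i)) => [|j]; last by rewrite /= eq_sym.
  by rewrite prodr_const cardC1 card_ord.
by rewrite prodr_const card_ord -exprM mulnC.
Qed.

(* Reflecting each [y_i] through [x_i] cannot beat the maximum either, so only
   the second-order error of the product of the two survives. *)
Lemma maximizer_stable x y (r e : R) :
  (forall z, pair_prod z <= pair_prod x) -> 0 < pair_prod x -> 0 < e ->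
  (forall i j, i != j -> e <= sqdist (tnth x i) (tnth x j)) ->
  (forall i, sqdist (tnth x i) (tnth y i) <= r) ->
  r + 4 * r / e <= 1 ->
  pair_prod x * (1 - (r + 4 * r / e)) ^+ (2 * (N * N.-1)) <= pair_prod y.
Proof.
move=> xmax x0 e0 ex xy L1; set t := 1 - _.
have t0 : 0 <= t by rewrite subr_ge0.
pose y' := [tuple reflect_at (tnth x i) (tnth y i) | i < N].
rewrite -(ler_pM2l x0); apply: le_trans (_ : pair_prod y * pair_prod y' <= _).
  rewrite mulrA -expr2 mulnC exprM -prod_pairs_const -prodrXl -prodrXl /pair_prod.
  rewrite -!big_split /=; apply: ler_prod => p pp.
  by rewrite -exprMn sqr_ge0 !tnth_mktuple sqdist_reflect_ge // ex.
by rewrite mulrC ler_wpM2r ?pair_prod_ge0.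
Qed.

End pair_product.

(** * Antipodes and the case of two points *)

Section antipodes.
Context {R : realType}.
Implicit Types (x y : sphere R).

Lemma antipode_subproof x : dot (- sphere_val x) (- sphere_val x) = 1.
Proof. by rewrite -(dot_sphere x) /dot /=; ring. Qed.

Definition antipode x : sphere R := sphere_of (antipode_subproof x).

Lemma sqdist_antipode x : sqdist x (antipode x) = 4.
Proof.
rewrite sqdistE sphere_ofE.
transitivity (2 + 2 * dot (sphere_val x) (sphere_val x)).
  by rewrite /dot /=; ring.
by rewrite dot_sphere; ring.
Qed.

Lemma sqdist_le4 x y : sqdist x y <= 4.
Proof. by have := dot_sphere_ge x y; rewrite sqdistE; lra. Qed.

Lemma sqdist_eq4 x y : sqdist x y = 4 -> y = antipode x.
Proof.
rewrite sqdistE => xy; apply: dot_eq1; rewrite sphere_ofE.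
transitivity (- dot (sphere_val x) (sphere_val y)); last by lra.
by rewrite /dot /=; ring.
Qed.

(** On the unit sphere |y - z|^2 = 4 - |y + z|^2, and y + z is the difference of x + z and x - y,
    both of squared norm at most r; the parallelogram law bounds its squared norm by 4r. *)
Lemma sqdist_near_antipodes (r : R) x y (z : sphere R) :
  sqdist x y <= r -> sqdist (antipode x) z <= r -> 4 - 4 * r <= sqdist y z.
Proof.
rewrite /sqdist !sqr_enorm !sphere_ofE => xy xz.
have := dot_sphere y; have := dot_sphere z; move: xy xz.
case: (sphere_val x) (sphere_val y) (sphere_val z) =>
  [[a1 a2] a3] [[b1 b2] b3] [[c1 c2] c3].
rewrite /dot /=.
have := sqr_ge0 (a1 - b1 + a1 + c1); have := sqr_ge0 (a2 - b2 + a2 + c2).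
have := sqr_ge0 (a3 - b3 + a3 + c3).
by lra.
Qed.

Lemma pair_prod2 (x : 2.-tuple (sphere R)) :
  pair_prod x = sqdist (tnth x ord0) (tnth x ord_max) ^+ 2.
Proof.
rewrite (pair_prod_split ord0) [X in _ * X]big1 ?mulr1 => [|k k0].
  by rewrite (big_pred1 ord_max) // => -[[|[|]]].
by rewrite big_pred0 // => j; case: k k0 j => [[|[|]] ?] // _ [[|[|]]].
Qed.

(** Comparison with an antipodal pair shows that a maximizer is one; both points of y are then near
    antipodes. *)
Lemma pair_prod2_stable (x y : 2.-tuple (sphere R)) (r : R) :
  (forall z : 2.-tuple (sphere R), pair_prod z <= pair_prod x) -> r <= 1 ->
  (forall i, sqdist (tnth x i) (tnth y i) <= r) ->
  pair_prod x * (1 - r) ^+ 2 <= pair_prod y.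
Proof.
move=> xmax r1 xy.
have x4 : sqdist (tnth x ord0) (tnth x ord_max) = 4.
  apply/eqP; rewrite eq_le sqdist_le4 /=.
  pose a := tnth x ord0; have := xmax [tuple a; antipode a].
  rewrite !pair_prod2 /= ler_pXn2r ?nnegrE ?sqdist_ge0 //.
  by rewrite sqdist_antipode.
have := sqdist_eq4 x4 => xmE.
have := xy ord0; have := xy ord_max; rewrite xmE => r1' r0'.
have := sqdist_near_antipodes r0' r1'.
rewrite !pair_prod2 x4 -exprMn => H.
by rewrite ler_pXn2r ?nnegrE ?sqdist_ge0 //; lra.
Qed.

End antipodes.

(** * Existence of a minimizer of the energy *)

Section min_attained.
Context {R : realType}.

Lemma sphere_param_surj (x : sphere R) : exists2 p : R * R,
  (0 <= p.1 <= pi) && (0 <= p.2 <= 2 * pi) & sphere_param p = x.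
Proof.
have := dot_sphere x; case E : (sphere_val x) => [[a b] c] abc.
rewrite /dot /= in abc.
have c1 : -1 <= c <= 1 by apply/andP; split; nra.
set s := Num.sqrt (1 - c ^+ 2).
have ss : s ^+ 2 = 1 - c ^+ 2 by rewrite sqr_sqrtr //; nra.
have s0 : 0 <= s by exact: sqrtr_ge0.
have thI : 0 <= acos c <= pi by rewrite acos_ge0 // acos_lepi.
have pi0 := pi_ge0 R.
have cosE : cos (acos c) = c by rewrite acosK.
have sinE : sin (acos c) = s by rewrite sin_acos.
(* At the poles the azimuth is arbitrary and a / s is meaningless. *)
have [s0'|sn0] := eqVneq s 0.
  have a0 : a = 0 by nra.
  have b0 : b = 0 by nra.
  exists (acos c, 0) => /=; first by rewrite thI lexx /= mulr_ge0.
  apply: sphere_eq; rewrite E /sphere_val /= /spherical_coord /=.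
  by rewrite cosE sinE s0' a0 b0 !mul0r.
have sp : 0 < s by rewrite lt_neqAle eq_sym sn0.
have as1 : -1 <= a / s <= 1.
  by rewrite ler_pdivrMr // ler_pdivlMr //; apply/andP; split; nra.
set ph := acos (a / s).
have cphE : cos ph = a / s by rewrite acosK.
have sphE : sin ph = `|b| / s.
  rewrite sin_acos // -[RHS]ger0_norm ?divr_ge0 // -sqrtr_sqr; congr Num.sqrt.
  rewrite !expr_div_n ss real_normK ?num_real //.
  have : 1 - c ^+ 2 != 0 by rewrite -ss sqrf_eq0.
  move=> h; apply: (mulfI h); rewrite mulrBr mulr1 ![_ * (_ / _)]mulrC.
  by rewrite !divfK //; lra.
have ph0 : 0 <= ph <= pi by rewrite acos_ge0 // acos_lepi.
have [b0|b0] := leP 0 b.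
  exists (acos c, ph) => /=; first by rewrite thI /=; lra.
  apply: sphere_eq; rewrite E /sphere_val /= /spherical_coord /=.
  rewrite cosE sinE cphE sphE ger0_norm //.
  by congr (_, _, _); field.
(* [acos] only yields azimuths in [0, pi], where b >= 0; a negative b takes the symmetric angle. *)
exists (acos c, 2 * pi - ph) => /=; first by rewrite thI /=; lra.
apply: sphere_eq; rewrite E /sphere_val /= /spherical_coord /=.
have -> : 2 * pi - ph = - ph + pi *+ 2 by lra.
rewrite cosD2pi sinD2pi cosN sinN.
rewrite cosE sinE cphE sphE ltr0_norm //.
by congr (_, _, _); field.
Qed.

Lemma continuous_prodr (T : topologicalType) (I : Type) (s : seq I) (P : pred I)
    (F : I -> T -> R) :
  (forall i, continuous (F i)) -> continuous (fun t => \prod_(i <- s | P i) F i t).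
Proof.
move=> cF; elim: s => [|i s IH].
  rewrite (_ : (fun t => _) = cst 1); first exact: cst_continuous.
  by apply/funext => t; rewrite big_nil.
rewrite (_ : (fun t => _) = fun t => (if P i then F i t else 1) *
    \prod_(i <- s | P i) F i t); last first.
  by apply/funext => t; rewrite big_cons; case: ifP => // _; rewrite mul1r.
by case: (P i) => t; apply: cvgM; [exact: cF|exact: IH|exact: cvg_cst|exact: IH].
Qed.

Lemma continuous_sqdist_param (T : topologicalType) (f g : T -> R * R) :
  continuous f -> continuous g ->
  continuous (fun t => sqdist (sphere_param (f t)) (sphere_param (g t))).
Proof.
move=> cf cg t.
rewrite (_ : (fun t => _) = fun t => 2 - 2 *
    dot (spherical_coord (f t)) (spherical_coord (g t))); last first.
  by apply/funext => u; rewrite sqdistE.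
rewrite /dot /spherical_coord /=.
have cfst (h : T -> R * R) : continuous h -> (h u).1 @[u --> t] --> (h t).1.
  by move=> ch; apply: continuous_comp; [exact: ch|exact: cvg_fst].
have csnd (h : T -> R * R) : continuous h -> (h u).2 @[u --> t] --> (h t).2.
  by move=> ch; apply: continuous_comp; [exact: ch|exact: cvg_snd].
have csin (h : T -> R) : h u @[u --> t] --> h t -> sin (h u) @[u --> t] --> sin (h t).
  by move=> ch; apply: continuous_comp; [exact: ch|exact: continuous_sin].
have ccos (h : T -> R) : h u @[u --> t] --> h t -> cos (h u) @[u --> t] --> cos (h t).
  by move=> ch; apply: continuous_comp; [exact: ch|exact: continuous_cos].
apply: cvgB; first exact: cvg_cst.
apply: cvgM; first exact: cvg_cst.
apply: cvgD; [apply: cvgD|]; apply: cvgM; do ?[apply: cvgM];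
  by [apply: csin; apply: cfst | apply: ccos; apply: cfst |
      apply: csin; apply: csnd | apply: ccos; apply: csnd].
Qed.

Context (N : nat).

(** In spherical coordinates the product is a continuous function on a product of closed rectangles
    of angles, compact by Tychonoff, and these coordinates reach every configuration. *)
Lemma pair_prod_max : exists x : N.-tuple (sphere R),
  forall y : N.-tuple (sphere R), pair_prod y <= pair_prod x.
Proof.
pose T : topologicalType := prod_topology (fun _ : 'I_N => (R * R)%type).
pose conf (f : T) := [tuple sphere_param (f i) | i < N].
pose A : set T := [set f : T | forall i,
  (`[0, pi] `*` `[0, 2 * pi]) (f i)].
have A0 : A !=set0.
  exists (fun=> (0, 0)) => i; split; rewrite /= in_itv /= lexx ?pi_ge0 //.
  by rewrite mulr_ge0 ?pi_ge0.
have cA : compact A.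
  apply: (@tychonoff 'I_N (fun=> (R * R)%type) (fun=> `[0, pi] `*` `[0, 2 * pi])).
  by move=> _; apply: compact_setX; exact: segment_compact.
have cF : continuous (fun f : T => pair_prod (conf f)).
  apply: continuous_prodr => p f.
  rewrite (_ : (fun t => _) = fun t : T =>
      sqdist (sphere_param (t p.1)) (sphere_param (t p.2))); last first.
    by apply/funext => t; rewrite !tnth_mktuple.
  by apply: continuous_sqdist_param; exact: proj_continuous.
have [f _ fmax] := compact_EVT_max A0 cA (continuous_subspaceT cF).
exists (conf f) => y.
have /choice[g gP] : forall i, exists p, (`[0, pi] `*` `[0, 2 * pi]) p /\
    sphere_param p = tnth y i.
  move=> i; have [p /andP[p1 p2] pE] := sphere_param_surj (tnth y i).
  by exists p; split.
rewrite (_ : y = conf g); last first.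
  by apply: eq_from_tnth => i; rewrite tnth_mktuple; case: (gP i).
by apply: fmax; rewrite inE => i; case: (gP i).
Qed.

(** Points at the distinct heights i/N on one meridian are pairwise distinct. *)
Lemma pair_prod_gt0_ex : exists x : N.-tuple (sphere R), 0 < pair_prod x.
Proof.
pose z (i : 'I_N) : R := i%:R / N%:R.
have z1 i : z i <= 1.
  rewrite /z ler_pdivrMr ?ltr0n ?(leq_ltn_trans (leq0n i)) //.
  by rewrite mul1r ler_nat ltnW.
have z0 i : 0 <= z i by rewrite divr_ge0.
have zz i : dot (Num.sqrt (1 - z i ^+ 2), 0, z i) (Num.sqrt (1 - z i ^+ 2), 0, z i) = 1.
  by rewrite /dot /= -!expr2 sqr_sqrtr ?subr_ge0 ?expr_le1 //; ring.
exists [tuple sphere_of (zz i) | i < N].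
apply: prodr_gt0 => -[i j] /= ij; rewrite !tnth_mktuple.
rewrite lt_neqAle sqdist_ge0 andbT eq_sym; apply: contra ij => /eqP.
rewrite sqdistE => d0; have /dot_eq1 /(congr1 (@sphere_val R)) :
    dot (sphere_val (sphere_of (zz i))) (sphere_val (sphere_of (zz j))) = 1 by lra.
rewrite !sphere_ofE => -[_]; rewrite /z => /divIf.
rewrite pnatr_eq0 -lt0n (leq_ltn_trans (leq0n i)) // => /(_ isT) /eqP.
by rewrite eqr_nat => /eqP ?; apply/eqP/val_inj.
Qed.

Lemma pair_prod_max_gt0 : exists2 x : N.-tuple (sphere R), 0 < pair_prod x &
  forall y : N.-tuple (sphere R), pair_prod y <= pair_prod x.
Proof.
have [x xmax] := pair_prod_max; have [y y0] := pair_prod_gt0_ex.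
by exists x => //; exact: lt_le_trans (xmax y).
Qed.

Lemma min_log_energyE (x : N.-tuple (sphere R)) : 0 < pair_prod x ->
  (forall y : N.-tuple (sphere R), pair_prod y <= pair_prod x) ->
  log_energy x = min_log_energy N.
Proof.
move=> x0 xmax; apply/eqP; rewrite eq_le; apply/andP; split; last first.
  by apply: ereal_inf_lbound; exists x.
apply: le_ereal_inf_tmp => _ [y _ <-]; rewrite !log_energyE (gt_eqF x0).
case: ifPn => [|y0]; first by rewrite leey.
have yp : 0 < pair_prod y by rewrite lt_neqAle eq_sym y0 pair_prod_ge0.
by rewrite lee_fin lerN2 ler_pM2r // ler_ln ?posrE.
Qed.

End min_attained.

(** * Caps *)

Section cap_measure.
Context {R : realType}.
Implicit Types t T : R.

Lemma sin_cos_MVT t : 0 <= t -> exists2 c, 0 <= c <= t & sin t = cos c * t.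
Proof.
move=> t0.
have dsin (u : R) : u \in `]0, t[ -> is_derive u 1 sin (cos u).
  by move=> _; exact: is_derive_sin.
have csin : {within `[0, t], continuous (@sin R)}.
  by apply: continuous_subspaceT => u; exact: continuous_sin.
have [c] := MVT_segment t0 dsin csin.
by rewrite in_itv /= sin0 !subr0; exists c.
Qed.

Lemma sin_ler t : 0 <= t -> sin t <= t.
Proof.
move=> t0; have [c _ ->] := sin_cos_MVT t0.
by rewrite ler_piMl // cos_le1.
Qed.

Lemma sqr_sin_le t : sin t ^+ 2 <= t ^+ 2.
Proof.
wlog t0 : t / 0 <= t => [H|].
  have [|t0] := leP 0 t; first exact: H.
  by rewrite -sqrrN -[leRHS]sqrrN -sinN H // oppr_ge0 ltW.
by have [c _ ->] := sin_cos_MVT t0; rewrite exprMn ler_piMl ?sqr_ge0.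
Qed.

Lemma cos_sub1E t : 1 - cos t = 2 * sin (t / 2) ^+ 2.
Proof.
rewrite {1}(_ : t = (t / 2) *+ 2); last by lra.
by rewrite cos_mulr2n; have := cos2Dsin2 (t / 2); lra.
Qed.

Lemma cos_sub1_le t : 1 - cos t <= t ^+ 2 / 2.
Proof. by rewrite cos_sub1E; have := sqr_sin_le (t / 2); lra. Qed.

Lemma sin_ge_cubic t : 0 <= t -> t * (1 - t ^+ 2 / 2) <= sin t.
Proof.
move=> t0; have [c /andP[c0 ct] ->] := sin_cos_MVT t0.
rewrite mulrC ler_wpM2r //; have := cos_sub1_le c.
suff : c ^+ 2 <= t ^+ 2 by lra.
by rewrite ler_pXn2r ?nnegrE // (le_trans c0).
Qed.

Lemma cos_sub1_ge t : 0 <= t <= 1 -> t ^+ 2 / 2 * (1 - t ^+ 2 / 4) <= 1 - cos t.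
Proof.
move=> /andP[t0 t1]; rewrite cos_sub1E.
have h0 : 0 <= t / 2 by rewrite divr_ge0.
have := sin_ge_cubic h0; set h := t / 2; set s := sin h => hs.
have tE : t = 2 * h by rewrite /h; lra.
have h1 : 0 <= h * (1 - h ^+ 2 / 2) by rewrite mulr_ge0 //; nra.
have : (h * (1 - h ^+ 2 / 2)) ^+ 2 <= s ^+ 2.
  by rewrite ler_pXn2r ?nnegrE // (le_trans h1).
by rewrite tE; have := sqr_ge0 (h ^+ 3); lra.
Qed.

Lemma sqdist_param (p q : R * R) :
  sqdist (sphere_param p) (sphere_param q) <=
  (p.1 - q.1) ^+ 2 + sin p.1 * sin q.1 * (2 * (1 - cos (p.2 - q.2))).
Proof.
have -> : sqdist (sphere_param p) (sphere_param q) = 2 * (1 - cos (p.1 - q.1)) +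
    sin p.1 * sin q.1 * (2 * (1 - cos (p.2 - q.2))).
  by rewrite sqdistE !cosB /dot /sphere_val /= /spherical_coord /=; ring.
by rewrite lerD2r; have := cos_sub1_le (p.1 - q.1); lra.
Qed.

(** The window of polar angles starts at [th] and goes towards the equator, so that it stays in
    [0, pi] and sees a large area element. The last bound is on the integral of the sine over the
    window, which makes up the polar part of the area of a cap. *)
Lemma polar_window (th T : R) : 0 <= th <= pi -> 0 < T -> T <= 2 / 5 ->
  exists p : R, [/\ 0 <= p, p + T <= pi,
    forall t, p <= t <= p + T -> (t - th) ^+ 2 <= T ^+ 2 /\ sin t <= sin th + T &
    T * (1 - 7 / 10 * T) * (sin th + T / 2) <= cos p - cos (p + T)].
Proof.
move=> thI T0 T25.
have s0 : 0 <= sin th by exact: sin_ge0_pi.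
have s1 := sin_le1 th; have c1 := cos_le1 th; have cN1 := cos_geN1 th.
have cs := cos2Dsin2 th.
have pi2 := pi_ge2 R.
have window u : 0 <= u <= T -> 0 <= sin u <= T.
  move=> /andP[u0 uT]; rewrite (le_trans (sin_ler u0)) // andbT.
  by apply: sin_ge0_pi; rewrite u0 /=; lra.
have sle (u a : R) : 0 <= u <= T -> `|a| <= 1 ->
    sin th * cos u + a * sin u <= sin th + T.
  move=> /window/andP[u0 uT] a1; rewrite lerD //; first by rewrite ler_piMr // cos_le1.
  by rewrite (le_trans _ uT) // ler_piMl // (le_trans (ler_norm _)).
(* Both hemispheres reduce to this bound with [c0] the absolute value of cos th; the constant 7/10
   suits T <= 2/5. *)
have H c0 : 0 <= c0 -> c0 ^+ 2 + sin th ^+ 2 = 1 ->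
    T * (1 - 7 / 10 * T) * (sin th + T / 2) <= sin th * sin T + c0 * (1 - cos T).
  move=> c00 cs0.
  have sT : sin th * (T * (1 - T ^+ 2 / 2)) <= sin th * sin T.
    by rewrite ler_wpM2l // sin_ge_cubic // ltW.
  have cT : c0 * (T ^+ 2 / 2 * (1 - T ^+ 2 / 4)) <= c0 * (1 - cos T).
    by rewrite ler_wpM2l // cos_sub1_ge //; lra.
  apply: le_trans (lerD sT cT); set s := sin th in s0 s1 cs0 *.
  have c0s : 1 - s <= c0 by nra.
  have c01 : c0 <= 1 by nra.
  rewrite -subr_ge0 (_ : _ - _ = T ^+ 2 * (s * (7 / 10 - T / 2) +
    (c0 * (1 - T ^+ 2 / 4) - 1 + 7 / 10 * T) / 2)); last by field.
  rewrite mulr_ge0 ?sqr_ge0 //.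
  have : (1 - s) * (1 - T ^+ 2 / 4) <= c0 * (1 - T ^+ 2 / 4).
    by rewrite ler_wpM2r //; nra.
  have : 0 <= s * T ^+ 2 by rewrite mulr_ge0 ?sqr_ge0.
  have : 0 <= s * (2 / 5 - T) by rewrite mulr_ge0 //; lra.
  by nra.
have [thpi|thpi] := leP th (pi / 2).
  exists th; split; [lra|lra| |].
    move=> t tI; split; first by nra.
    have uI : 0 <= t - th <= T by lra.
    rewrite (_ : t = th + (t - th)); last by lra.
    by rewrite sinD sle // cos_max.
  rewrite cosD; have := H (cos th) _ cs.
  have -> : cos th - (cos th * cos T - sin th * sin T) =
    sin th * sin T + cos th * (1 - cos T) by ring.
  by apply; apply: cos_ge0_pihalf; lra.
exists (th - T); split; [lra|lra| |].
  move=> t tI; split; first by nra.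
  have uI : 0 <= th - t <= T by lra.
  rewrite (_ : t = th - (th - t)); last by lra.
  by rewrite sinB -mulNr sle // normrN cos_max.
rewrite subrK cosB; have := H (- cos th) _.
have -> : cos th * cos T + sin th * sin T - cos th =
    sin th * sin T + - cos th * (1 - cos T) by ring.
rewrite sqrrN; apply=> //; rewrite oppr_ge0.
have := cosDpi (th - pi); rewrite subrK => ->.
by rewrite oppr_le0; apply: cos_ge0_pihalf; lra.
Qed.

Local Notation leb := (@lebesgue_measure R).

Lemma integral_sin (a b : R) : a < b ->
  (\int[leb]_(t in `[a, b]) (sin t)%:E = (cos a - cos b)%:E)%E.
Proof.
move=> ab; rewrite (@continuous_FTC2 _ _ (fun t => - cos t)) //.
- by rewrite -EFinB opprK addrC.
- by apply: continuous_subspaceT => x; exact: continuous_sin.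
- split.
  + by move=> x _; apply: derivableN.
  + by apply: cvgN; apply: cvg_at_right_filter; exact: continuous_cos.
  + by apply: cvgN; apply: cvg_at_left_filter; exact: continuous_cos.
- by move=> x _; rewrite derive1E deriveN // derive_val opprK.
Qed.

Lemma integral_sin_rect (a b c d : R) : a < b -> c < d ->
  (forall t, a <= t <= b -> 0 <= sin t) ->
  (\int[leb \x leb]_(p in `[a, b] `*` `[c, d]) (sin p.1)%:E =
   ((cos a - cos b) * (d - c))%:E)%E.
Proof.
move=> ab cd s0; set D := _ `*` _.
have mD : measurable D by apply: measurableX; exact: measurable_itv.
rewrite integral_mkcond; set f := (X in (\int[_]_p X p)%E).
have f0 p : (0 <= f p)%E.
  rewrite /f patchE; case: ifPn => // /set_mem [+ _].
  by rewrite /= in_itv /= lee_fin => /s0.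
have mf : measurable_fun setT f.
  apply/(measurable_restrictT _ mD).
  exact: measurable_sin_chart.
have fE t s : f (t, s) = if (t \in `[a, b]%classic) && (s \in `[c, d]%classic)
    then (sin t)%:E else 0%E by rewrite /f patchE in_setX.
rewrite fubini_tonelli1 //.
transitivity (\int[leb]_(t in `[a, b]) ((sin t)%:E * (d - c)%:E))%E.
  rewrite [RHS]integral_mkcond; apply: eq_integral => t _.
  rewrite /fubini_F patchE; case: ifPn => tI.
    transitivity (\int[leb]_(s in `[c, d]) (cst (sin t)%:E s))%E.
      rewrite [RHS]integral_mkcond; apply: eq_integral => s _.
      by rewrite [LHS]fE patchE tI.
    by rewrite integral_cst //= lebesgue_measure_itv /= lte_fin cd -EFinB.
  by apply: integral0_eq => s _; rewrite [LHS]fE (negbTE tI).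
rewrite ge0_integralZr //=.
- by rewrite integral_sin // -EFinM.
- by apply/measurable_funTS/measurable_EFinP; exact: measurable_sin.
- by rewrite lee_fin subr_ge0 ltW.
Qed.

Definition cap (x : sphere R) (r : R) : set (sphere R) :=
  [set y | sqdist x y <= r].

Lemma measurable_cap x r : measurable (cap x r).
Proof.
rewrite /cap -[X in measurable X]setTI.
apply: (measurable_fun_le (f := sqdist x)) => //.
apply: measurable_funX; apply: measurable_enormB; first exact: measurable_cst.
exact: measurable_sphere_val.
Qed.

Lemma azimuth_window (ph Y : R) : 0 <= ph <= 2 * pi -> 0 < Y -> Y <= 2 ->
  exists q : R, [/\ 0 <= q, q + Y <= 2 * pi &
    forall t, q <= t <= q + Y -> (t - ph) ^+ 2 <= Y ^+ 2].
Proof.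
move=> phI Y0 Y2; have pi2 := pi_ge2 R.
have [php|php] := leP ph pi.
  by exists ph; split; [lra|lra|move=> t tI; nra].
by exists (ph - Y); split; [lra|lra|move=> t tI; nra].
Qed.

(** The cap contains a rectangle of angles of sides [T] and [Y]. The width [Y] is such that the
    azimuth contributes at most (sin th + T) sin th Y^2 <= (sin th + T/2)^2 Y^2 = T^2 to the squared
    distance, and the shift T/2 keeps it bounded near the poles. The area is at least T^2 (1 -
    7T/10), and 4 pi < 16. *)
Lemma sphere_unif_cap (x : sphere R) (T : R) : 0 < T -> T <= 2 / 5 ->
  ((T ^+ 2 * (1 - 7 / 10 * T) / 16)%:E <= sphere_unif (cap x (2 * T ^+ 2)))%E.
Proof.
move=> T0 T25; have [[th ph] /= /andP[thI phI] <-] := sphere_param_surj x.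
have s0 : 0 <= sin th by exact: sin_ge0_pi.
have sT : 0 < sin th + T / 2 by rewrite ltr_wpDl // divr_gt0.
set Y := T / (sin th + T / 2).
have Y0 : 0 < Y by rewrite divr_gt0.
have Y2 : Y <= 2 by rewrite ler_pdivrMr //; lra.
have YE : Y * (sin th + T / 2) = T by rewrite divfK // gt_eqF.
have [p [p0 pT win areaT]] := polar_window thI T0 T25.
have [q [q0 qY winq]] := azimuth_window phI Y0 Y2.
have spos t : p <= t <= p + T -> 0 <= sin t by move=> tI; apply: sin_ge0_pi; lra.
rewrite /sphere_unif lee_pdivlMl ?mulr_gt0 ?pi_gt0 // /sphere_area.
have rect :
    (\int[leb \x leb]_(z in `[p, (p + T)%R] `*` `[q, (q + Y)%R]) (sin z.1)%:E =
    ((cos p - cos (p + T)) * Y)%:E)%E.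
  by rewrite integral_sin_rect ?ltrDl // addrAC subrr add0r.
apply: (@le_trans _ _ ((cos p - cos (p + T)) * Y)%:E); last first.
  rewrite -rect.
  apply: ge0_subset_integral.
  - by apply: measurableX; exact: measurable_itv.
  - apply: measurableI; first exact: measurable_chart.
    rewrite -[X in measurable X]setTI.
    by apply: measurable_sphere_param => //; exact: measurable_cap.
  - exact: measurable_sin_chart.
  - by move=> z [/sin_chart_ge0].
  - move=> z [] /=; rewrite !in_itv /= => z1 z2; split.
      by split; lra.
    rewrite /cap /= sqdistC (le_trans (sqdist_param _ _)) //=.
    have [d1 sz] := win _ z1; have d2 := winq _ z2.
    have sz0 := spos _ z1.
    have c2 := cos_sub1_le (z.2 - ph).
    have H1 : sin z.1 * sin th * (2 * (1 - cos (z.2 - ph))) <=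
        (sin th + T) * sin th * Y ^+ 2.
      have c0 := cos_le1 (z.2 - ph).
      apply: ler_pM; [exact: mulr_ge0|lra| |lra].
      by rewrite ler_wpM2r.
    have H2 : (sin th + T) * sin th * Y ^+ 2 <= T ^+ 2.
      have -> : T ^+ 2 = (sin th + T / 2) ^+ 2 * Y ^+ 2.
        by rewrite -exprMn mulrC YE.
      rewrite ler_wpM2r ?sqr_ge0 //.
      by have := sqr_ge0 T; lra.
    by lra.
rewrite -EFinM lee_fin.
have pi4 := pihalf_lt2 R.
have H : T * (1 - 7 / 10 * T) * T <= (cos p - cos (p + T)) * Y.
  rewrite (_ : T * _ * T = T * (1 - 7 / 10 * T) * (sin th + T / 2) * Y).
    by rewrite ler_wpM2r // ltW.
  by rewrite -[RHS]mulrA [_ * Y]mulrC YE.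
apply: le_trans H; rewrite expr2.
have : 0 <= T * T * (1 - 7 / 10 * T) by rewrite mulr_ge0 ?mulr_ge0 ?ltW //; lra.
set A := T * T * (1 - _); move=> A0.
rewrite (_ : T * (1 - 7 / 10 * T) * T = A); last by rewrite /A; ring.
by nra.
Qed.

End cap_measure.

(** * The partition function *)

Section partition_function.
Context {R : realType}.

(** Concavity of the logarithm between 1 - k and 1, with weight 1/b on the former. *)
Lemma powR_bernoulli (k b : R) : 0 <= k < 1 -> 1 <= b ->
  1 - k <= (1 - k / b) `^ b.
Proof.
move=> /andP[k0 k1] b1; have b0 : 0 < b by lra.
have kb : k / b <= k by rewrite ler_pdivrMr //; nra.
have bi : 0 <= b^-1 <= 1 by rewrite invr_ge0 invf_le1 // b1 ltW.
have [tge tle] := andP bi.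
pose t : {i01 R} := Itv01 tge tle.
have k1' : (0 : R) < 1 - k by lra.
have := concave_ln t (a := 1 - k) (b := 1) k1' ltr01.
rewrite !convRE /= ln1 mulr0 addr0 mulr1 /unstable.onem.
rewrite (_ : b^-1 * (1 - k) + (1 - b^-1) = 1 - k / b); last by ring.
rewrite ler_pdivrMl // => ln_le.
have kb1 : 0 < 1 - k / b by lra.
rewrite /powR gt_eqF // -{1}(lnK (x := 1 - k)) ?posrE //.
by rewrite ler_expR.
Qed.

Lemma measurable_weight N (beta : R) :
  measurable_fun setT
    (fun y : N.-tuple (sphere R) => expeR (- (beta%:E * log_energy y))).
Proof.
apply: (measurableT_comp measurable_expeR).
apply: measurableT_comp => //; apply: measurable_funeM.
exact: measurable_log_energy.
Qed.

(** Keep only the product of the caps around the points of x: its mass is at least g^N, and the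
    weight there is at least a^(beta/2). *)
Lemma boltzmann_ge N (beta : R) (x : N.-tuple (sphere R)) (r a g : R) :
  0 < beta -> 0 <= a -> 0 <= g ->
  (forall y, (forall i, sqdist (tnth x i) (tnth y i) <= r) -> a <= pair_prod y) ->
  (forall i, (g%:E <= sphere_unif (cap (tnth x i) r))%E) ->
  ((a `^ (beta / 2) * g ^+ N)%:E <= boltzmann beta [set: N.-tuple (sphere R)])%E.
Proof.
move=> b0 a0 g0 ay gx.
pose B := [set y : N.-tuple (sphere R) | forall i, cap (tnth x i) r (tnth y i)].
have mB : measurable B.
  rewrite (_ : B = \bigcap_(i in [set: 'I_N])
      ((fun y : N.-tuple (sphere R) => tnth y i) @^-1` cap (tnth x i) r)).
    apply: fin_bigcap_measurable => // i _; rewrite -[X in measurable X]setTI.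
    by apply: measurable_tnth => //; exact: measurable_cap.
  by apply/seteqP; split => y /= yB i; [move=> _|]; apply: yB.
have mw := @measurable_weight N beta.
apply: (@le_trans _ _ (\int[prob_power sphere_unif N]_(y in B)
    (a `^ (beta / 2))%:E)%E).
  rewrite integral_cst // EFinM lee_wpmul2l ?lee_fin ?powR_ge0 //.
  have BE : prob_power sphere_unif N B =
      (\prod_(i < N) sphere_unif (cap (tnth x i) r))%E.
    exact: (@prob_power_box _ _ _ _ _ (fun i => cap (tnth x i) r)
      (fun i => measurable_cap (tnth x i) r)).
  have gE i : sphere_unif (cap (tnth x i) r) =
      (fine (sphere_unif (cap (tnth x i) r)))%:E.
    by rewrite fineK // fin_num_measure //; exact: measurable_cap.
  rewrite [leRHS]BE (eq_bigr _ (fun i _ => gE i)) prodEFin lee_fin.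
  rewrite -[X in _ ^+ X]card_ord -prodr_const; apply: ler_prod => i _.
  by rewrite g0 -lee_fin -gE gx.
rewrite /boltzmann; apply: (@le_trans _ _ (\int[prob_power sphere_unif N]_(y in B)
    expeR (- (beta%:E * log_energy y)))%E).
  apply: ge0_le_integral => //.
  - by move=> y _; rewrite lee_fin powR_ge0.
  - exact: measurable_funTS.
  - move=> y yB; rewrite expe_log_energy // lee_fin.
    by rewrite ge0_ler_powR ?nnegrE ?pair_prod_ge0 ?ay // divr_ge0 // ltW.
apply: ge0_subset_integral => //.
by move=> y _; exact: expeR_ge0.
Qed.
Lemma boltzmann_ge2 (beta : R) (x : 2.-tuple (sphere R)) : 1 <= beta ->
  (forall y : 2.-tuple (sphere R), pair_prod y <= pair_prod x) ->
  ((pair_prod x `^ (beta / 2) / (beta * 2 ^+ 8) ^+ 2)%:E <=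
     boltzmann beta [set: 2.-tuple (sphere R)])%E.
Proof.
move=> b1 xmax; have b0 : 0 < beta by lra.
(* With this radius, Bernoulli's inequality leaves a factor at least 3/4 of the maximal weight. *)
set r := 1 / 4 / beta.
have r0 : 0 < r by rewrite divr_gt0.
have r4 : r <= 1 / 4 by rewrite ler_pdivrMr //; lra.
set T := Num.sqrt (r / 2).
have T0 : 0 < T by rewrite sqrtr_gt0 divr_gt0.
have TT : T ^+ 2 = r / 2 by rewrite sqr_sqrtr // divr_ge0 // ltW.
have T25 : T <= 2 / 5 by nra.
set g := T ^+ 2 * (1 - 7 / 10 * T) / 16.
(* The value is (1 - 7/10 * 2/5) / 32, the worst ratio of the cap bound to r when T <= 2/5. *)
have [q qE] : exists q : R, q = 9 / 400 by exists (9 / 400).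
have q0 : 0 < q by lra.
have g0 : q * r <= g by rewrite /g TT; nra.
have qr0 : 0 <= q * r by rewrite mulr_ge0 // ltW.
have M0 := pair_prod_ge0 x.
have r1 : 0 <= 1 - r by lra.
apply: le_trans (boltzmann_ge (x := x) (r := r) (a := pair_prod x * (1 - r) ^+ 2)
  (g := g) b0 _ _ _ _).
- rewrite lee_fin powRM ?sqr_ge0 // -mulrA ler_wpM2l ?powR_ge0 //.
  rewrite -[(1 - r) ^+ 2]powR_mulrn // -powRrM.
  rewrite (_ : _ * (beta / 2) = beta); last by field.
  have H : 3 / 4 <= (1 - r) `^ beta.
    have := @powR_bernoulli (1 / 4) beta; rewrite -/r.
    by move=> /(_ _ b1); lra.
  have rE : r * beta = 1 / 4 by rewrite /r divfK // gt_eqF.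
  have gg : (q * r) ^+ 2 <= g ^+ 2.
    by rewrite lerXn2r ?nnegrE // (le_trans qr0).
  apply: le_trans (_ : 3 / 4 * (q * r) ^+ 2 <= _); last first.
    by apply: ler_pM H gg; [lra|exact: sqr_ge0].
  rewrite -[leLHS]mul1r ler_pdivrMr ?exprn_gt0 ?mulr_gt0 //.
  rewrite (_ : 3 / 4 * _ * _ = 3 / 4 * (q * (r * beta) * 2 ^+ 8) ^+ 2); last by field.
  by rewrite rE qE; lra.
- by rewrite mulr_ge0 // sqr_ge0.
- exact: le_trans g0.
- by move=> y xy; apply: pair_prod2_stable => //; lra.
- move=> i; have := sphere_unif_cap (tnth x i) T0 T25.
  by rewrite (_ : 2 * T ^+ 2 = r) // TT mulrC divfK ?pnatr_eq0.
Qed.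

(** The arithmetic behind the exponent 8, with k = N - 1. In the variable k - 2 all coefficients of
    the difference of the two sides are nonnegative. *)
Lemma cap_budget (k : R) : 2 <= k ->
  4 * k * (1 + 2 / 3 * (k * (k + 1) * (2 * k + 1))) <=
  93 / 3200 * (k + 1) ^+ 8.
Proof.
move=> k2; rewrite (_ : k = 2 + (k - 2)); last by ring.
have : 0 <= k - 2 by lra.
move: (k - 2) => m m0.
have m2 : 0 <= m ^+ 2 by exact: sqr_ge0.
have m3 : 0 <= m ^+ 3 by exact: exprn_ge0.
have m4 : 0 <= m ^+ 4 by exact: exprn_ge0.
have m5 : 0 <= m ^+ 5 by exact: exprn_ge0.
have m6 : 0 <= m ^+ 6 by exact: exprn_ge0.
have m7 : 0 <= m ^+ 7 by exact: exprn_ge0.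
have m8 : 0 <= m ^+ 8 by exact: exprn_ge0.
by lra.
Qed.

Lemma boltzmann_ge3 N (beta : R) (x : N.-tuple (sphere R)) :
  (2 < N)%N -> 1 <= beta -> 0 < pair_prod x ->
  (forall y : N.-tuple (sphere R), pair_prod y <= pair_prod x) ->
  ((pair_prod x `^ (beta / 2) / (beta * N%:R ^+ 8) ^+ N)%:E <=
     boltzmann beta [set: N.-tuple (sphere R)])%E.
Proof.
move=> N3 b1 x0 xmax; have b0 : 0 < beta by lra.
set k : R := N.-1%:R.
have NE : N%:R = k + 1 by rewrite /k natr1 prednK // (ltn_trans _ N3).
have k2 : 2 <= k by rewrite /k ler_nat; lia.
have [S SE] : exists S, S = k * (k + 1) * (2 * k + 1) by eexists.
have S30 : 30 <= S by rewrite SE; nra.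
have [K KE] : exists K, K = 1 + 2 / 3 * S by eexists.
have K21 : 21 <= K by lra.
have d0 : 0 < 2 * beta * k * K by rewrite !mulr_gt0 //; lra.
(* The relative loss per squared pair is r K = 1 / (2 beta k). Over all pairs its total exponent is
   beta k N, so by Bernoulli's inequality each point costs a factor at least 1/2. *)
have [r r0 rE] : exists2 r, 0 < r & r * (2 * beta * k * K) = 1.
  by exists (2 * beta * k * K)^-1; rewrite ?invr_gt0 // mulVf // gt_eqF.
set T := Num.sqrt (r / 2).
have T0 : 0 < T by rewrite sqrtr_gt0 divr_gt0.
have TT : T ^+ 2 = r / 2 by rewrite sqr_sqrtr // divr_ge0 // ltW.
have r84 : r <= 1 / 84.
  have bk2 : 2 <= beta * k by nra.
  have : 0 <= (beta * k - 2) * (K - 21) by rewrite mulr_ge0; lra.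
  have bkK : 84 <= 2 * beta * k * K by nra.
  by nra.
have T10 : T <= 1 / 10 by nra.
have T25 : T <= 2 / 5 by lra.
set g := T ^+ 2 * (1 - 7 / 10 * T) / 16.
(* As T <= 1/10 here, the ratio of the cap bound to r is at least (1 - 7/100) / 32. *)
have [q qE] : exists q : R, q = 93 / 3200 by exists (93 / 3200).
have q0 : 0 < q by lra.
have g0 : q * r <= g by rewrite /g TT; nra.
have qr0 : 0 <= q * r by rewrite mulr_ge0 // ltW.
(* The lower bound on squared distances in a maximizer, from [maximizer_pairs_separated]; [K] is
   exactly 1 + 4/e. *)
set e := 6 / S.
have e0 : 0 < e by rewrite divr_gt0 //; lra.
have LE : r + 4 * r / e = r * K.
  by rewrite /e KE; field; rewrite gt_eqF //; lra.
have bk : 1 <= beta * k by nra.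
have rK : r * K = 1 / 2 / (beta * k).
  rewrite -[RHS]mul1r -rE; field; rewrite !gt_eqF //; lra.
have rK1 : r * K <= 1 by rewrite rK ler_pdivrMr; nra.
apply: le_trans (boltzmann_ge (x := x) (r := r)
  (a := pair_prod x * (1 - r * K) ^+ (2 * (N * N.-1))) (g := g) b0 _ _ _ _).
- have t0 : 0 <= 1 - r * K by lra.
  rewrite lee_fin powRM ?exprn_ge0 ?(ltW x0) // -mulrA ler_wpM2l ?powR_ge0 //.
  rewrite -[_ ^+ (2 * _)]powR_mulrn // -powRrM.
  rewrite (_ : _ * (beta / 2) = beta * k * N%:R); last first.
    by rewrite !natrM -/k; field.
  rewrite powRrM powR_mulrn ?powR_ge0 // -exprMn -exprVn.
  have H : 1 / 2 <= (1 - r * K) `^ (beta * k).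
    have := @powR_bernoulli (1 / 2) (beta * k); rewrite rK.
    by move=> /(_ _ bk); lra.
  apply: lerXn2r; rewrite ?nnegrE.
  - by rewrite invr_ge0 mulr_ge0 ?exprn_ge0 ?ler0n // ltW.
  - by rewrite mulr_ge0 ?powR_ge0 // (le_trans qr0).
  apply: le_trans (_ : 1 / 2 * (q * r) <= _); last first.
    by apply: ler_pM H g0; lra.
  have N0 : 0 < beta * N%:R ^+ 8 by rewrite mulr_gt0 // exprn_gt0 // NE; lra.
  rewrite -[leLHS]mul1r ler_pdivrMr //.
  have budget : 4 * k * K <= q * N%:R ^+ 8.
    by rewrite NE qE KE SE cap_budget.
  rewrite (_ : 1 / 2 * (q * r) * _ = 1 / 2 * (r * beta) * (q * N%:R ^+ 8)).
    apply: le_trans (_ : 1 / 2 * (r * beta) * (4 * k * K) <= _).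
      by move: rE; lra.
    by rewrite ler_wpM2l // !mulr_ge0 // ltW.
  by ring.
- by rewrite mulr_ge0 ?exprn_ge0 ?(ltW x0) //; lra.
- exact: le_trans g0.
- move=> y xy; rewrite -LE; apply: maximizer_stable => //; last by rewrite LE.
  move=> i j ij; rewrite /e ler_pdivrMr; last by lra.
  have := maximizer_pairs_separated xmax x0 (_ : j != i).
  rewrite eq_sym => /(_ ij); rewrite !natrM -!natr1 -/k -muln2 natrM -/k SE; lra.
- move=> i; have := sphere_unif_cap (tnth x i) T0 T25.
  by rewrite (_ : 2 * T ^+ 2 = r) // TT mulrC divfK ?pnatr_eq0.
Qed.

End partition_function.

(** * The Gibbs measure *)

(** The density [w] has the same integrals over measurable sets as the Radon-Nikodym derivative of
    [nu], hence equals it almost everywhere. *)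
Lemma integral_density d (T : measurableType d) (R : realType)
    (nu : {finite_measure set T -> \bar R})
    (mu : {sigma_finite_measure set T -> \bar R}) (w f : T -> \bar R) :
  measurable_fun setT w -> measurable_fun setT f -> (forall t, 0 <= f t)%E ->
  (forall A, measurable A -> nu A = \int[mu]_(t in A) w t)%E ->
  (\int[nu]_t f t = \int[mu]_t (f t * w t))%E.
Proof.
move=> mw mf f0 nuw.
have numu : nu `<< mu.
  apply/null_content_dominatesP => A mA A0.
  by rewrite nuw // null_set_integral //; exact: measurable_funTS.
rewrite -(Radon_Nikodym_SigmaFinite.change_of_variables numu) //.
have mg := measurable_int _ (Radon_Nikodym_SigmaFinite.f_integrable numu).
apply: ae_eq_integral => //; [exact: emeasurable_funM|exact: emeasurable_funM|].
apply: ae_eqe_mul2l => /=; apply: integral_ae_eq => //.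
  exact: Radon_Nikodym_SigmaFinite.f_integrable.
by move=> A _ mA; rewrite -Radon_Nikodym_SigmaFinite.f_integral // nuw.
Qed.

Section gibbs.
Context {R : realType} (N : nat) (beta : R) (x : N.-tuple (sphere R)).
Context (beta_ge1 : 1 <= beta) (N2 : (1 < N)%N) (x_gt0 : 0 < pair_prod x).
Context (xmax : forall y : N.-tuple (sphere R), pair_prod y <= pair_prod x).

Let b0 : 0 < beta. Proof. exact: lt_le_trans beta_ge1. Qed.

Local Notation sigmaN := (prob_power (@sphere_unif R) N).
Local Notation Z := (boltzmann beta [set: N.-tuple (sphere R)]).
Local Notation w y := (expeR (- (beta%:E * log_energy y))).

Let Emin : R := - (ln (pair_prod x) / 2).
Let ell : R := N%:R * (ln beta + 8 * ln N%:R).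

Lemma log_energy_ge (y : N.-tuple (sphere R)) : (Emin%:E <= log_energy y)%E.
Proof.
rewrite log_energyE; case: ifPn => [_|y0]; first by rewrite leey.
have yp : 0 < pair_prod y by rewrite lt_neqAle eq_sym y0 pair_prod_ge0.
by rewrite lee_fin lerN2 ler_pM2r // ler_ln ?posrE.
Qed.

Lemma weight_max : pair_prod x `^ (beta / 2) = expR (- (beta * Emin)).
Proof. by rewrite /powR gt_eqF // /Emin; congr expR; ring. Qed.

Lemma weight_le (y : N.-tuple (sphere R)) (e : R) : (e%:E <= log_energy y)%E ->
  (w y <= (expR (- (beta * e)))%:E)%E.
Proof.
move=> ey; rewrite -[leRHS]/(expeR (- (beta * e))%:E) ler_expeR EFinN EFinM.
by rewrite leeN2 lee_wpmul2l // lee_fin ltW.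
Qed.

Lemma boltzmann_le (A : set (N.-tuple (sphere R))) (e : R) : measurable A ->
  (forall y, A y -> (e%:E <= log_energy y)%E) ->
  (boltzmann beta A <= (expR (- (beta * e)))%:E)%E.
Proof.
move=> mA Ae; apply: (@le_trans _ _ (\int[sigmaN]_(y in A) (expR (- (beta * e)))%:E)%E).
  apply: ge0_le_integral => //.
  - by move=> y _; exact: expeR_ge0.
  - by apply: measurable_funTS; exact: measurable_weight.
  - by move=> y /Ae; exact: weight_le.
rewrite integral_cst // -[leRHS]mule1 lee_wpmul2l ?lee_fin ?expR_ge0 //.
exact: probability_le1.
Qed.

Lemma boltzmann_gt : ((expR (- (beta * Emin) - ell))%:E <= Z)%E.
Proof.
have NR : 0 < N%:R :> R by rewrite ltr0n ltnW.
have -> : expR (- (beta * Emin) - ell) =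
    pair_prod x `^ (beta / 2) / (beta * N%:R ^+ 8) ^+ N.
  rewrite expRD -weight_max expRN; congr (_ / _).
  have -> : ell = ln ((beta * N%:R ^+ 8) ^+ N).
    by rewrite lnXn ?lnM ?posrE ?lnXn ?mulr_gt0 ?exprn_gt0 // /ell; ring.
  by rewrite lnK // posrE exprn_gt0 // mulr_gt0 // exprn_gt0.
move: N2; rewrite leq_eqVlt => /predU1P[N2'|N3]; last exact: boltzmann_ge3.
by move: x xmax; rewrite -N2' => x' xmax'; exact: boltzmann_ge2.
Qed.

Let z : R := fine Z.

Lemma boltzmann_fin : Z = z%:E.
Proof.
rewrite fineK // ge0_fin_numE //.
have := boltzmann_le (e := Emin) measurableT (fun y _ => log_energy_ge y).
by move/le_lt_trans; apply; exact: ltry.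
Qed.

Lemma z_ge : expR (- (beta * Emin) - ell) <= z.
Proof. by rewrite -lee_fin -boltzmann_fin boltzmann_gt. Qed.

Lemma z_gt0 : 0 < z.
Proof. exact: lt_le_trans (expR_gt0 _) z_ge. Qed.

Lemma coulomb_gasE A : coulomb_gas N beta A = (boltzmann beta A * z^-1%:E)%E.
Proof.
(* Z is positive and finite, so [mnormalize] does divide by it. *)
have Z0 : (Z == 0%E) || (Z == +oo%E) = false.
  by rewrite boltzmann_fin orbF eqe gt_eqF // z_gt0.
rewrite /coulomb_gas /= /mnormalize; case: ifPn => // h.
by suff : false by []; rewrite -Z0; exact: h.
Qed.

(** Markov's inequality in exponential form: on A the weight is at most e^(- beta e), the reference
    measure has mass at most 1, and Z is at least e^(- beta Emin - ell). *)
Lemma coulomb_gas_le (A : set (N.-tuple (sphere R))) (e : R) : measurable A ->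
  (forall y, A y -> (e%:E <= log_energy y)%E) ->
  (coulomb_gas N beta A <= (expR (ell - beta * (e - Emin)))%:E)%E.
Proof.
move=> mA Ae; rewrite coulomb_gasE lee_pdivrMr ?z_gt0 //.
apply: (le_trans (boltzmann_le mA Ae)).
rewrite -EFinM lee_fin -[leLHS]mulr1.
apply: le_trans (_ : expR (ell - beta * (e - Emin)) * expR (- (beta * Emin) - ell) <= _).
  by rewrite mulr1 -expRD ler_expR; lra.
by rewrite ler_wpM2l ?expR_ge0 // z_ge.
Qed.

Lemma coulomb_gas_mean :
  (\int[coulomb_gas N beta]_y log_energy y - Emin%:E <= (ell / beta)%:E)%E.
Proof.
pose u (y : N.-tuple (sphere R)) : \bar R := (log_energy y - Emin%:E)%E.
have mu : measurable_fun setT u.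
  by apply: emeasurable_funB => //; exact: measurable_log_energy.
have u0 y : (0 <= u y)%E by rewrite sube_ge0 // log_energy_ge.
have ell0 : 0 <= ell.
  by rewrite /ell mulr_ge0 // addr_ge0 ?mulr_ge0 // ln_ge0 // ler1n ltnW.
have dens A : measurable A ->
    (coulomb_gas N beta A = \int[sigmaN]_(y in A) (z^-1%:E * w y))%E.
  move=> mA; rewrite coulomb_gasE ge0_integralZl //.
  - by rewrite muleC.
  - by apply: measurable_funTS; exact: measurable_weight.
  - by move=> y _; exact: expeR_ge0.
  - by rewrite lee_fin invr_ge0 ltW // z_gt0.
have mbu : measurable_fun setT (fun y => expeR (beta%:E * u y)).
  by apply: (measurableT_comp measurable_expeR); exact: measurable_funeM.
have intC (c : R) : (\int[coulomb_gas N beta]_y c%:E = c%:E)%E.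
  rewrite integral_cst // [X in (_ * X)%E](_ : _ = 1%E) ?mule1 //.
  exact: probability_setT.
(* The factor e^(beta u) cancels the Gibbs weight up to the constant e^(- beta Emin), so the
   integral is at most e^(- beta Emin) / Z. *)
have expu : (\int[coulomb_gas N beta]_y expeR (beta%:E * u y) <= (expR ell)%:E)%E.
  rewrite (integral_density (mu := sigmaN)
    (w := fun y => (z^-1%:E * w y)%E)) //; last 2 first.
  - by apply: measurable_funeM; exact: measurable_weight.
  - by move=> y; exact: expeR_ge0.
  apply: (@le_trans _ _ (\int[sigmaN]_y (expR ell)%:E)%E); last first.
    rewrite integral_cst // -[leRHS]mule1 lee_wpmul2l ?lee_fin ?expR_ge0 //.
    exact: probability_le1.
  apply: ge0_le_integral => //.
  - move=> y _; rewrite mule_ge0 ?expeR_ge0 // mule_ge0 ?expeR_ge0 //.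
    by rewrite lee_fin invr_ge0 ltW // z_gt0.
  - apply: emeasurable_funM => //.
    by apply: measurable_funeM; exact: measurable_weight.
  move=> y _; rewrite /u log_energyE; case: ifPn => _.
    (* Where points collide the integrand is +oo times 0, which is 0. *)
    by rewrite gt0_muley //= !mule0 lee_fin expR_ge0.
  set h := - (ln (pair_prod y) / 2).
  rewrite -EFinB -!EFinM lee_fin mulrCA ler_pdivrMl ?z_gt0 //.
  rewrite -expRD; apply: le_trans (_ : expR (- (beta * Emin) - ell) * expR ell <= _).
    by rewrite -expRD ler_expR; lra.
  by rewrite ler_wpM2r ?expR_ge0 // z_ge.
have gibbs : (\int[coulomb_gas N beta]_y (beta%:E * u y + 1) <=
     \int[coulomb_gas N beta]_y
       (ell%:E + (expR (- ell))%:E * expeR (beta%:E * u y)))%E.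
  apply: ge0_le_integral => //.
  - by move=> y _; rewrite adde_ge0 // mule_ge0 // lee_fin ltW.
  - by apply: emeasurable_funD => //; exact: measurable_funeM.
  - by apply: emeasurable_funD => //; exact: measurable_funeM.
  move=> y _; have := u0 y; case: (u y) => [v _| |//].
    rewrite -!EFinM /= -?EFinM -!EFinD lee_fin -expRD.
    (* The tangent line bound 1 + t <= e^t at t = beta u - ell. *)
    by have := expR_ge1Dx (- ell + beta * v); lra.
  by move=> _;
    rewrite !gt0_muley ?lte_fin ?expR_gt0 //= gt0_muley ?lte_fin ?expR_gt0.
have intu : (\int[coulomb_gas N beta]_y u y <= (ell / beta)%:E)%E.
  have EL : (\int[coulomb_gas N beta]_y (beta%:E * u y + 1) =
      beta%:E * \int[coulomb_gas N beta]_y u y + 1)%E.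
    rewrite ge0_integralD //.
    - by rewrite intC ge0_integralZl // lee_fin ltW.
    - by move=> y _; rewrite mule_ge0 // lee_fin ltW.
    - exact: measurable_funeM.
  have ER : (\int[coulomb_gas N beta]_y
        (ell%:E + (expR (- ell))%:E * expeR (beta%:E * u y)) =
      ell%:E + (expR (- ell))%:E *
        \int[coulomb_gas N beta]_y expeR (beta%:E * u y))%E.
    rewrite ge0_integralD //.
    - rewrite intC ge0_integralZl ?lee_fin ?expR_ge0 // => y _.
      exact: expeR_ge0.
    - by move=> y _; rewrite mule_ge0 ?expeR_ge0 // lee_fin expR_ge0.
    - exact: measurable_funeM.
  move: gibbs; rewrite EL ER.
  move=> /le_trans; move=> /(_ (ell + 1)%:E).
  have -> : (ell%:E + (expR (- ell))%:E *
      \int[coulomb_gas N beta]_y expeR (beta%:E * u y) <= (ell + 1)%:E)%E.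
    rewrite EFinD leeD2l // (_ : 1 = expR (- ell) * expR ell).
      by rewrite EFinM lee_wpmul2l // lee_fin expR_ge0.
    by rewrite -expRD addNr expR0.
  move=> /(_ isT); rewrite EFinD leeD2rE //.
  by rewrite [(ell / beta)%:E]EFinM lee_pdivlMr // muleC.
(* Since [Emin] may be negative, splitting the integral of [u y + Emin] relies on integrability,
   which the bound just proved provides. *)
have iu : (coulomb_gas N beta).-integrable setT u.
  apply/integrableP; split => //.
  under eq_integral => y _ do rewrite gee0_abs //.
  exact: le_lt_trans intu (ltry _).
have -> : (\int[coulomb_gas N beta]_y log_energy y =
    \int[coulomb_gas N beta]_y (u y + Emin%:E))%E.
  by apply: eq_integral => y _; rewrite /u subeK.
rewrite integralD //; last exact: finite_measure_integrable_cst.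
rewrite intC addeK //.
Qed.

End gibbs.

Theorem theorem1p1 (R : realType) (N : nat) (beta : R)
    (hN : (2 <= N)%N) (hbeta : 1 <= beta) :
  [/\ (exists x : N.-tuple (sphere R), log_energy x = min_log_energy N),
      (forall c : R, 0 < c ->
        let kappa :=
          c * (beta / N%:R) * ln N%:R - ln beta - 8 * ln N%:R in
        ((1 - expR (- (kappa * N%:R)))%:E <=
          coulomb_gas N beta
            [set x | (log_energy x - min_log_energy N <=
                      (c * ln N%:R)%:E)%E])%E)
    & ((\int[coulomb_gas N beta]_x log_energy x) - min_log_energy N <=
        ((N%:R / beta) * (ln beta + 8 * ln N%:R))%:E)%E].
Proof.
have [x x0 xmax] := @pair_prod_max_gt0 R N.
have xmin := min_log_energyE x0 xmax.
have b0 : 0 < beta by exact: lt_le_trans hbeta.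
have N0 : N%:R != 0 :> R by rewrite pnatr_eq0 -lt0n ltnW.
split; first by exists x.
- move=> c c0; cbv zeta; set kappa := _ - 8 * _.
  rewrite -xmin log_energyE gt_eqF //.
  set Emin := - (_ / _); set A := [set y | _].
  have mA : measurable A.
    rewrite /A -[X in measurable X]setTI.
    apply: emeasurable_fun_le => //.
    by apply: emeasurable_funB => //; exact: measurable_log_energy.
  have AC y : (~` A) y -> ((Emin + c * ln N%:R)%:E <= log_energy y)%E.
    move=> /= /negP; rewrite -ltNge => /ltW.
    by rewrite leeBrDr // EFinD addeC.
  have := coulomb_gas_le hbeta hN x0 xmax (measurableC mA) AC.
  rewrite probability_setC // leeBlDr ?fin_num_measure //.
  (* The exponents agree because kappa N = beta c log N - ell, with ell = N (log beta + 8 log N). *)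
  set k := expR _; rewrite (_ : expR (- (kappa * N%:R)) = k); last first.
    by rewrite /k; congr expR; rewrite /kappa -/Emin; field.
  by rewrite EFinB leeBlDl.
- have := coulomb_gas_mean hbeta hN x0 xmax.
  rewrite -xmin log_energyE gt_eqF // => /le_trans; apply.
  by rewrite lee_fin le_eqVlt; apply/orP; left; apply/eqP; field; rewrite gt_eqF.
Qed.
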